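(* Let $\mathcal S,\mathcal D,\mathcal Q,\mathcal R$ be upscaling and downscaling operators satisfying the technical conditions (boundedness, reproduction of constants, smoothness, first-order linearity on constant data) listed in the context, together with the nonlinear quadrature mirror filter equation $$\mathcal S\mathcal D c\ \oplus\ \mathcal R\mathcal Q\big(c\ominus\mathcal S\mathcal D c\big)=c\qquad\text{for all } c .$$ Let $(c^{(j)})_{j\ge 0}$ be a data pyramid, $c^{(j-1)}=\mathcal D c^{(j)}$ for $j\ge1$, with details $d^{(j)}=\mathcal Q(c^{(j)}\ominus\mathcal S c^{(j-1)})$, such that $$\|\Delta c^{(j)}\|\lesssim\mu^j\quad\text{for all } j\ge 0,\ \text{for some } \mu\in(0,1).$$ Then reconstruction of $c^{(j)}$ from coarse data $c^{(0)}$ and details $d^{(1)},\dots,d^{(j)}$ is stable in the following sense: there exist constants $D,E_1,E_2>0$ such that for all $j$ and for any further data pyramid $(\widetilde c^{(i)})_{i\ge0}$ with details $(\widetilde d^{(i)})_{i\ge1}$, the conditions $$\|c^{(0)}-\widetilde c^{(0)}\|\le E_1\quad\text{and}\quad \|d^{(k)}-\widetilde d^{(k)}\|\le E_2\,\mu^k\ \text{ for all } k$$ imply $$\|c^{(j)}-\widetilde c^{(j)}\|\le D\Big(\|c^{(0)}-\widetilde c^{(0)}\|+\sum_{k=1}^j\|d^{(k)}-\widetilde d^{(k)}\|\Big).$$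
   Context: Setting (coordinate representation). $V,W$ are finite-dimensional normed vector spaces. The operations $\oplus: V\times W\to V$ and $\ominus:V\times V\to W$ are coordinate representations of ''point plus vector'' and ''difference of points'' on a manifold, defined on open subsets ($V$ stands for a convex coordinate domain where this matters). They are smooth, satisfy $p\oplus(q\ominus p)=q$, and are Lipschitz; in particular there are constants $A,B>0$ with $A\|p-q\|\le\|p\ominus q\|\le B\|p-q\|$. On sequences they act elementwise. For a sequence $w=(w_i)_{i\in\mathbb Z}$, $\|w\|:=\sup_i\|w_i\|$; $(\Delta c)_i:=c_{i+1}-c_i$. The symbol $\lesssim$ means $\le$ up to a uniform multiplicative constant. $L$ is the left shift $(Lc)_k=c_{k+1}$. Operators. $\mathcal S,\mathcal D$ map sequences in $V$ to sequences in $V$; $\mathcal Q,\mathcal R$ map sequences in $W$ to sequences in $W$. They are local (each output entry depends only on a uniformly bounded number of nearby input entries, relative to the up-/downscaling of indices) and satisfy $\mathcal SL=L^2\mathcal S$, $\mathcal RL=L^2\mathcal R$, $\mathcal DL^2=L\mathcal D$, $\mathcal QL^2=L\mathcal Q$. All sequences considered lie in the domains where the operations are defined. Technical conditions. (1) Boundedness: $\|\mathcal Qw\|\lesssim\|w\|$ and $\|\mathcal Rw\|\lesssim\|w\|$. (2) Reproduction of constants: $\mathcal Sc=c$ and $\mathcal Dc=c$ for constant sequences $c$. (3) Smoothness: $\mathcal S,\mathcal D,\mathcal Q,\mathcal R$ are $C^1$ with (uniformly) Lipschitz derivative. (4) First-order linearity on constant data: for all constant sequences $c$, $d\mathcal S|_c=S_{lin}$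 and $d\mathcal D|_c=D_{lin}$, where $(S_{lin}c)_k=\sum_l\alpha_{k-2l}c_l$ and $(D_{lin}c)_k=\sum_l\beta_{l-2k}c_l$ are linear low-pass upscaling and downscaling operators with finitely supported real filters $\alpha,\beta$. Moreover either $S_{lin}$ is a convergent subdivision rule (for each bounded $c$ there is a continuous $f:\mathbb R\to V$ with $\sup_k\|(S_{lin}^jc)_k-f(2^{-j}k)\|\to0$ as $j\to\infty$, with $f\not\equiv 0$ for some $c$), or we are in the Haar case, where $\mathcal S=S_{lin}$ is the splitting rule $(\mathcal Sc)_{2k}=(\mathcal Sc)_{2k+1}=c_k$. Pyramids. Data are reconstructed from coarse data and details recursively by $c^{(k)}=\mathcal Sc^{(k-1)}\oplus\mathcal Rd^{(k)}$. The further data pyramid $\widetilde c^{(i)}$ with details $\widetilde d^{(i)}$ is related to its details in this way: $\widetilde c^{(k)}=\mathcal S\widetilde c^{(k-1)}\oplus\mathcal R\widetilde d^{(k)}$ for $k\ge1$.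
   Formalization: The operation ⊕ is additionally assumed to have a uniformly Lipschitz differential, and for each point p the set of vectors that can be added to p is assumed star-shaped about 0; without these uniformity conditions stability can fail. *)

(* Defs.v *)
From HB Require Import structures.
From mathcomp Require Import all_boot all_order all_algebra.
From mathcomp Require Import all_classical all_reals all_analysis.

Set Implicit Arguments.
Unset Strict Implicit.
Unset Printing Implicit Defensive.

Import Order.TTheory GRing.Theory Num.Theory.
Import numFieldNormedType.Exports.

Local Open Scope classical_set_scope.
Local Open Scope ring_scope.

Definition finite_dim (R : realType) (V : normedModType R) : Prop :=
  exists (n : nat) (b : 'I_n -> V),
    forall v, exists a : 'I_n -> R, v = \sum_(i < n) a i *: b i.

(* Bi-infinite sequences are functions on int. *)

Definition seq_in (V : Type) (U : set V) (c : int -> V) : Prop :=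
  forall i, U (c i).

Definition shift (V : Type) (c : int -> V) : int -> V := fun i => c (i + 1).

Definition Delta (V : zmodType) (c : int -> V) : int -> V :=
  fun i => c (i + 1) - c i.

(* Elementwise action of a binary operation, and the condition that every
   elementwise application takes place inside the domain dom. *)
Definition elementwise (X Y Z : Type) (op : X -> Y -> Z)
    (x : int -> X) (y : int -> Y) : int -> Z := fun i => op (x i) (y i).

Definition elementwise_defined (X Y : Type) (dom : set (X * Y))
    (x : int -> X) (y : int -> Y) : Prop := forall i, dom (x i, y i).

(* The sup norm of a sequence; it is +oo when the sequence is unbounded. *)
Definition supnorm (R : realType) (V : normedModType R) (w : int -> V) : \bar R :=
  ereal_sup (range (fun i => (`|w i|)%:E)).
Arguments supnorm {R V} w%_R.

(* C^n on an open set, by iterated directional derivatives; on an open subset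
   of a finite-dimensional space this is the usual class C^n. *)
Fixpoint Cn (R : realType) (E F : normedModType R) (n : nat) (dom : set E)
    (f : E -> F) : Prop :=
  match n with
  | 0%N => forall x, dom x -> {for x, continuous f}
  | n'.+1 => (forall x, dom x -> differentiable f x) /\
             (forall v, Cn n' dom (fun x => 'D_v f x))
  end.

Definition smooth_on (R : realType) (E F : normedModType R) (dom : set E)
    (f : E -> F) : Prop := forall n, Cn n dom f.

Definition lipschitz_differential (R : realType) (E F : normedModType R)
    (dom : set E) (f : E -> F) : Prop :=
  exists K : R, forall x y v, dom x -> dom y ->
    `|'d f x v - 'd f y v| <= K * `|x - y| * `|v|.

(* "Point plus vector" and "difference of points" in coordinates.  U is the
   convex coordinate domain.  oplus p v is p (+) v, meaningful for
   (p, v) in dom_plus; ominus q p is q (-) p, meaningful for (q, p) in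
   dom_minus; both are total functions whose values elsewhere are irrelevant. *)
Record point_vector_ops (R : realType) (V W : normedModType R) (U : set V)
    (dom_plus : set (V * W)) (dom_minus : set (V * V))
    (oplus : V -> W -> V) (ominus : V -> V -> W) : Prop := PointVectorOps {
  pvo_open_points : open U ;
  pvo_convex_points : convex_set U ;
  pvo_open_plus : open dom_plus ;
  pvo_open_minus : open dom_minus ;
  pvo_diagonal : forall p, U p -> dom_minus (p, p) ;
  (* with p fixed, the vectors which can be added to p form a set which is
     star-shaped about 0 *)
  pvo_star : forall p v (t : R),
    dom_plus (p, v) -> 0 <= t <= 1 -> dom_plus (p, t *: v) ;
  pvo_smooth_plus : smooth_on dom_plus (fun x => oplus x.1 x.2) ;
  pvo_smooth_minus : smooth_on dom_minus (fun x => ominus x.1 x.2) ;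
  pvo_lipschitz_plus :
    exists K : R, K.-lipschitz_dom_plus (fun x => oplus x.1 x.2) ;
  pvo_lipschitz_minus :
    exists K : R, K.-lipschitz_dom_minus (fun x => ominus x.1 x.2) ;
  (* The Lipschitz property is required of the differential too: if only oplus
     itself were Lipschitz, its second derivatives could blow up along a
     sequence of points, and stability fails. *)
  pvo_lipschitz_diff_plus :
    lipschitz_differential dom_plus (fun x => oplus x.1 x.2) ;
  pvo_plus_minus : forall p q, dom_minus (q, p) ->
    dom_plus (p, ominus q p) /\ oplus p (ominus q p) = q ;
  pvo_bilipschitz : exists A B : R, [/\ 0 < A, 0 < B &
    forall p q, dom_minus (p, q) ->
      A * `|p - q| <= `|ominus p q| <= B * `|p - q| ]
}.

(* An operator on sequences is a total function on int -> V; only its values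
   on sequences in U matter. *)

Definition preserves (V : Type) (U : set V)
    (T : (int -> V) -> (int -> V)) : Prop :=
  forall c, seq_in U c -> seq_in U (T c).

(* Entry k of the output depends on entries near k / 2 of the input. *)
Definition upscaling (V : Type) (U : set V)
    (T : (int -> V) -> (int -> V)) : Prop :=
  (exists m : nat, forall c c' (k : int), seq_in U c -> seq_in U c' ->
     (forall l : int, `|2 * l - k| <= m%:Z -> c l = c' l) -> T c k = T c' k) /\
  (forall c, seq_in U c -> T (shift c) = shift (shift (T c))).

(* Entry k of the output depends on entries near 2 k of the input. *)
Definition downscaling (V : Type) (U : set V)
    (T : (int -> V) -> (int -> V)) : Prop :=
  (exists m : nat, forall c c' (k : int), seq_in U c -> seq_in U c' ->
     (forall l : int, `|l - 2 * k| <= m%:Z -> c l = c' l) -> T c k = T c' k) /\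
  (forall c, seq_in U c -> T (shift (shift c)) = shift (T c)).

Definition bounded_op (R : realType) (V : normedModType R)
    (T : (int -> V) -> (int -> V)) : Prop :=
  exists2 C : R, 0 < C & forall w, (supnorm (T w) <= C%:E * supnorm w)%E.

Definition reproduces_constants (V : Type) (U : set V)
    (T : (int -> V) -> (int -> V)) : Prop :=
  forall p, U p -> T (fun _ => p) = (fun _ => p).

(* dT|_c = A: entrywise Frechet derivative at c.  Each entry of T is a
   function of finitely many vectors, and so is each entry of A; the second
   condition makes A unique when U is open, since increments h of finite
   support are admissible as soon as they are small. *)
Record has_differential (R : realType) (V : normedModType R) (U : set V)
    (T : (int -> V) -> (int -> V)) (c : int -> V)
    (A : (int -> V) -> (int -> V)) : Prop := HasDifferential {
  hd_linear : forall (a : R) (h h' : int -> V) (k : int),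
    A (fun i => a *: h i + h' i) k = a *: A h k + A h' k ;
  hd_finite : forall k : int, exists n : nat, forall h : int -> V,
    (forall l : int, `|l| <= n%:Z -> h l = 0) -> A h k = 0 ;
  hd_approx : forall (k : int) (e : R), 0 < e -> exists2 r : R, 0 < r &
    forall h : int -> V, seq_in U (c \+ h) -> (supnorm h <= r%:E)%E ->
      ((`|T (c \+ h) k - T c k - A h k|)%:E <= e%:E * supnorm h)%E
}.

(* C^1 with uniformly Lipschitz derivative; the norm of dT|_c - dT|_c' is the
   operator norm for the sup norm. *)
Definition C1_lipschitz (R : realType) (V : normedModType R) (U : set V)
    (T : (int -> V) -> (int -> V)) : Prop :=
  exists dT : (int -> V) -> ((int -> V) -> (int -> V)),
    (forall c, seq_in U c -> has_differential U T c (dT c)) /\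
    (exists2 K : R, 0 < K & forall c c' h, seq_in U c -> seq_in U c' ->
       (supnorm (dT c h \- dT c' h) <=
          K%:E * supnorm (c \- c') * supnorm h)%E).

(* The low-pass property (the even and the odd entries of alpha, and the entries
   of beta, sum to 1) is not a separate assumption: it follows from reproduction
   of constants and first-order linearity as soon as U and V are nontrivial. *)
Definition finitely_supported (R : realType) (a : int -> R) : Prop :=
  exists n : nat, forall i : int, n%:Z < `|i| -> a i = 0.

Definition Slin (R : realType) (V : normedModType R) (alpha : int -> R)
    (c : int -> V) : int -> V :=
  fun k => \sum_(l \in [set: int]) alpha (k - 2 * l) *: c l.

Definition Dlin (R : realType) (V : normedModType R) (beta : int -> R)
    (c : int -> V) : int -> V :=
  fun k => \sum_(l \in [set: int]) beta (l - 2 * k) *: c l.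

Definition subdivision_limit (R : realType) (V : normedModType R)
    (T : (int -> V) -> (int -> V)) (c : int -> V) (f : R -> V) : Prop :=
  continuous f /\
  (fun j : nat => supnorm (fun k : int => iter j T c k - f (k%:~R / 2 ^+ j)))
    @ \oo --> 0%E.

Definition convergent_subdivision (R : realType) (V : normedModType R)
    (T : (int -> V) -> (int -> V)) : Prop :=
  (forall c, (supnorm c < +oo)%E -> exists f, subdivision_limit T c f) /\
  (exists c f, [/\ (supnorm c < +oo)%E, subdivision_limit T c f &
                   exists x, f x != 0]).

Definition haar_case (R : realType) (V : normedModType R) (U : set V)
    (S : (int -> V) -> (int -> V)) (alpha : int -> R) : Prop :=
  forall c, seq_in U c ->
    S c = Slin alpha c /\
    (forall k : int, S c (2 * k) = c k /\ S c (2 * k + 1) = c k).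

Record multiscale_operators (R : realType) (V W : normedModType R) (U : set V)
    (S D : (int -> V) -> (int -> V)) (Q Rd : (int -> W) -> (int -> W))
    (alpha beta : int -> R) : Prop := MultiscaleOperators {
  mo_S_preserves : preserves U S ;
  mo_D_preserves : preserves U D ;
  mo_S_upscaling : upscaling U S ;
  mo_R_upscaling : upscaling setT Rd ;
  mo_D_downscaling : downscaling U D ;
  mo_Q_downscaling : downscaling setT Q ;
  mo_Q_bounded : bounded_op Q ;
  mo_R_bounded : bounded_op Rd ;
  mo_S_constants : reproduces_constants U S ;
  mo_D_constants : reproduces_constants U D ;
  mo_S_smooth : C1_lipschitz U S ;
  mo_D_smooth : C1_lipschitz U D ;
  mo_Q_smooth : C1_lipschitz setT Q ;
  mo_R_smooth : C1_lipschitz setT Rd ;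
  mo_alpha_finite : finitely_supported alpha ;
  mo_beta_finite : finitely_supported beta ;
  mo_S_first_order : forall p, U p ->
    has_differential U S (fun _ => p) (Slin alpha) ;
  mo_D_first_order : forall p, U p ->
    has_differential U D (fun _ => p) (Dlin beta) ;
  mo_convergent_or_haar :
    convergent_subdivision (Slin alpha : (int -> V) -> (int -> V)) \/
    haar_case U S alpha
}.

(* The nonlinear quadrature mirror filter equation, for all sequences c for
   which both sides are defined. *)
Definition qmf (V W : Type) (U : set V)
    (dom_plus : set (V * W)) (dom_minus : set (V * V))
    (oplus : V -> W -> V) (ominus : V -> V -> W)
    (S D : (int -> V) -> (int -> V)) (Q Rd : (int -> W) -> (int -> W)) : Prop :=
  forall c, seq_in U c ->
    let p := S (D c) in
    let v := Rd (Q (elementwise ominus c p)) in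
    elementwise_defined dom_minus c p -> elementwise_defined dom_plus p v ->
    elementwise oplus p v = c.

(* d^(j) = Q (c^(j) (-) S c^(j-1)), meant for j >= 1. *)
Definition detail (V W : Type) (ominus : V -> V -> W)
    (S : (int -> V) -> (int -> V)) (Q : (int -> W) -> (int -> W))
    (c : nat -> int -> V) (j : nat) : int -> W :=
  Q (elementwise ominus (c j) (S (c j.-1))).

Record data_pyramid (V W : Type) (U : set V)
    (dom_plus : set (V * W)) (dom_minus : set (V * V))
    (ominus : V -> V -> W)
    (S D : (int -> V) -> (int -> V)) (Q Rd : (int -> W) -> (int -> W))
    (c : nat -> int -> V) : Prop := DataPyramid {
  dp_in : forall j, seq_in U (c j) ;
  dp_down : forall j, (0 < j)%N -> c j.-1 = D (c j) ;
  dp_minus_defined : forall j, (0 < j)%N ->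
    elementwise_defined dom_minus (c j) (S (c j.-1)) ;
  dp_plus_defined : forall j, (0 < j)%N ->
    elementwise_defined dom_plus (S (c j.-1)) (Rd (detail ominus S Q c j))
}.

(* The only relation used between the further pyramid and its details:
   c^(k) = S c^(k-1) (+) R d^(k) for k >= 1.  A data pyramid with its own
   details satisfies it by the quadrature mirror filter equation. *)
Record reconstructed_pyramid (V W : Type) (U : set V)
    (dom_plus : set (V * W)) (oplus : V -> W -> V)
    (S : (int -> V) -> (int -> V)) (Rd : (int -> W) -> (int -> W))
    (c : nat -> int -> V) (d : nat -> int -> W) : Prop := ReconstructedPyramid {
  rp_in : forall k, seq_in U (c k) ;
  rp_plus_defined : forall k, (0 < k)%N ->
    elementwise_defined dom_plus (S (c k.-1)) (Rd (d k)) ;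
  rp_step : forall k, (0 < k)%N ->
    c k = elementwise oplus (S (c k.-1)) (Rd (d k))
}.

(* Main.v *)
Require Import Defs.
From mathcomp Require Import all_boot all_order all_algebra.
From mathcomp Require Import all_classical all_reals all_analysis.
From mathcomp Require Import zify ring lra.
Import Order.TTheory GRing.Theory Num.Theory.
Import numFieldNormedType.Exports.
Local Open Scope classical_set_scope.
Local Open Scope ring_scope.

(** Write [e k] for the difference of the two pyramids at level [k], and [P] for
    the linear rule [Slin alpha].

    The details of the given pyramid are of size [mu ^+ k], since [S (D c)]
    differs from [c] by no more than a multiple of the oscillation of [c]
    ([up_down_near_data]).  Adding a vector [v] to a point is the identity up to
    a correction of size [v] whose dependence on the point has a Lipschitz
    constant proportional to the size of [v] ([oplus_increment_le]).  Therefore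
    [e k.+1] equals [S (c k) - S (c' k)] up to [mu ^+ k] times the size of that
    difference and a multiple of the change in the details
    ([reconstruction_step]).

    In the Haar case [S] copies entries and does not enlarge differences, so that
    a discrete Gronwall argument ([discrete_gronwall]) finishes the proof: the
    relative growth in step [k] is of order [mu ^+ k], which is summable.

    In the convergent case [S (c k) - S (c' k)] is [P (e k)] up to the product of
    the size of [e k] and the oscillation of the data, because the differential
    of [S] is [P] at constants and is Lipschitz ([upscaling_linearization]).
    Convergence of the linear rule makes the powers of [P] uniformly bounded and
    makes them contract differences geometrically ([convergent_contractive]).
    The contraction is indispensable: the oscillation of the second pyramid is
    controlled only through the differences of [e k], and these have to decay for
    the accumulated linearization errors to stay summable.  If the perturbation
    is small, then the decay of the differences and the bound on the sizes can be
    carried on together by induction over the levels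
    ([perturbed_contraction]). *)

Set Implicit Arguments.
Unset Strict Implicit.

(** * The sup norm, and the mean value inequality for curves *)

Lemma supnorm_leP (R : realType) (V : normedModType R) (w : int -> V) (r : R) :
  (supnorm w <= r%:E)%E <-> forall i, `|w i| <= r.
Proof.
split=> [wr i|wr].
  rewrite -lee_fin; apply: le_trans wr.
  by apply: ereal_sup_ubound; exists i.
by apply: ge_ereal_sup => _ [i _ <-]; rewrite lee_fin.
Qed.

Lemma supnorm_ge0 (R : realType) (V : normedModType R) (w : int -> V) :
  (0 <= supnorm w)%E.
Proof.
apply: (@le_trans _ _ (`|w 0|)%:E); first by rewrite lee_fin.
by apply: ereal_sup_ubound; exists 0.
Qed.

Lemma fine_supnormK (R : realType) (V : normedModType R) (w : int -> V) (r : R) :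
  (supnorm w <= r%:E)%E -> ((fine (supnorm w))%:E = supnorm w)%E.
Proof.
move=> wr; rewrite fineK // ge0_fin_numE ?supnorm_ge0 //.
exact: le_lt_trans wr (ltry _).
Qed.

(** The mean value inequality for vector valued curves: the supremum of the
    parameters up to which the slope bound holds cannot stop short of 1. *)
Lemma norm_increment_le (R : realType) (V : normedModType R) (phi : R -> V)
    (M : R) :
  (forall t, 0 <= t <= 1 -> forall e, 0 < e -> exists2 r, 0 < r &
     forall s, 0 <= s <= 1 -> `|s - t| <= r ->
       `|phi s - phi t| <= (M + e) * `|s - t|) ->
  `|phi 1 - phi 0| <= M.
Proof.
move=> loc; apply/ler_addgt0Pr => e e0.
pose A := [set t : R | (0 <= t <= 1) /\ `|phi t - phi 0| <= (M + e) * t].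
have A0 : A 0 by split; [rewrite lexx ler01|rewrite subrr normr0 mulr0].
have supA : has_sup A by split; [exists 0|exists 1 => t [/andP[]]].
set T := sup A.
have T01 : 0 <= T <= 1.
  apply/andP; split; first exact: sup_upper_bound.
  by apply: sup_le_ub; [exists 0|move=> t [/andP[]]].
have [r r0 rP] := loc T T01 e e0.
have AT : A T.
  split=> //; have [t At Tt] := sup_adherent r0 supA.
  have tT : t <= T by exact: sup_upper_bound.
  have [t01 tP] := At.
  have := rP t t01; rewrite distrC ger0_norm ?subr_ge0 // => /(_ _)/wrap[].
    by move: Tt; rewrite -/T; lra.
  move=> tT'; have -> : phi T - phi 0 = - (phi t - phi T) + (phi t - phi 0).
    by rewrite opprB subrKA.
  apply: le_trans (ler_normD _ _) _; rewrite normrN.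
  apply: le_trans (lerD tT' tP) _; lra.
have [T1|T1] := eqVneq T 1; first by case: AT => _; rewrite T1 mulr1.
have ltT1 : T < 1 by rewrite lt_neqAle T1; case/andP: T01.
pose s := Num.min 1 (T + r).
have Ts : T < s by rewrite /s lt_min ltT1 ltrDl.
have s01 : 0 <= s <= 1.
  by rewrite ge_min lexx /= (le_trans _ (ltW Ts)) //; case/andP: T01.
have sr : `|s - T| <= r.
  by rewrite ger0_norm ?subr_ge0 ?(ltW Ts) // lerBlDl ge_min lexx orbT.
suff /(sup_upper_bound supA) : A s by rewrite leNgt Ts.
split=> //; have sP := rP s s01 sr; have [_ TP] := AT.
rewrite (_ : phi s - phi 0 = (phi s - phi T) + (phi T - phi 0)); last first.
  by rewrite subrKA.
apply: le_trans (ler_normD _ _) _; apply: le_trans (lerD sP TP) _.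
rewrite ger0_norm ?subr_ge0 ?(ltW Ts) //; lra.
Qed.

Lemma convex_segment (R : realType) (V : normedModType R) (U : set V) (x y : V)
    (t : R) :
  convex_set U -> U x -> U y -> 0 <= t <= 1 -> U (x + t *: (y - x)).
Proof.
move=> Uc Ux Uy /andP[t0 t1].
have := Uc y x (@Itv01 _ t t0 t1); rewrite !inE => /(_ Uy Ux).
rewrite /conv /=; congr (U _).
rewrite /unstable.onem /= scalerBl scale1r scalerBr addrCA.
by [].
Qed.

(** * Operators on sequences along segments *)

Lemma hd_scale (R : realType) (V : normedModType R) (U : set V)
    (T : (int -> V) -> (int -> V)) c A : has_differential U T c A ->
  forall (a : R) h k, A (fun i => a *: h i) k = a *: A h k.
Proof.
move=> [lin _ _] a h k.
have A0 : A (fun _ => 0) k = 0.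
  have := lin 1 (fun _ => 0) (fun _ => 0) k.
  rewrite (_ : (fun i => _) = (fun _ => 0)); last first.
    by apply/funext => i; rewrite scaler0 addr0.
  by rewrite scale1r => /eqP; rewrite eq_sym -subr_eq0 addrK => /eqP.
have := lin a h (fun _ => 0) k.
rewrite A0 addr0 => <-; congr (A _ k).
by apply/funext => i; rewrite addr0.
Qed.

Lemma hd_approx_le (R : realType) (V : normedModType R) (U : set V)
    (T : (int -> V) -> (int -> V)) c A (k : int) (e : R) :
  has_differential U T c A -> 0 < e -> exists2 r, 0 < r &
    forall h x, seq_in U (c \+ h) -> (forall i, `|h i| <= x) -> x <= r ->
      `|T (c \+ h) k - T c k - A h k| <= e * x.
Proof.
move=> [_ _ app] e0; have [r r0 rP] := app k e e0.
exists r => // h x ch hx xr; rewrite -lee_fin.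
have hx' : (supnorm h <= x%:E)%E by apply/supnorm_leP.
apply: le_trans (rP h ch _) _; first by apply: le_trans hx' _; rewrite lee_fin.
by rewrite EFinM; apply: lee_wpmul2l => //; rewrite lee_fin ltW.
Qed.

Lemma seq_in_segment (R : realType) (V : normedModType R) (U : set V)
    (c c' : int -> V) (t : R) :
  convex_set U -> seq_in U c -> seq_in U c' -> 0 <= t <= 1 ->
  seq_in U (fun i => c i + t *: (c' i - c i)).
Proof. by move=> Uc Uc1 Uc2 t01 i; apply: convex_segment. Qed.

(** The entry [T c k] is integrated along the segment from [c] to [c'], which
    stays inside the convex domain.  The vector [a] is the value to which the
    derivative is compared. *)
Lemma op_increment_le (R : realType) (V : normedModType R) (U : set V)
    (T : (int -> V) -> (int -> V)) dT c c' (k : int) (x M : R) (a : V) :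
  convex_set U ->
  (forall c0, seq_in U c0 -> has_differential U T c0 (dT c0)) ->
  seq_in U c -> seq_in U c' -> (forall i, `|c' i - c i| <= x) ->
  (forall t, 0 <= t <= 1 ->
     `|dT (fun i => c i + t *: (c' i - c i)) (fun i => c' i - c i) k - a| <= M) ->
  `|T c' k - T c k - a| <= M.
Proof.
move=> Uc dTP Uc1 Uc2 hx dM.
pose h := fun i => c' i - c i.
pose p t := fun i => c i + t *: h i.
have x0 : 0 <= x by apply: le_trans (hx 0).
have Up t : 0 <= t <= 1 -> seq_in U (p t) by move=> ?; apply: seq_in_segment.
pose phi t := T (p t) k - t *: a.
have -> : T c' k - T c k - a = phi 1 - phi 0.
  have p1 : p 1 = c' by apply/funext => i; rewrite /p /h scale1r addrC subrK.
  have p0 : p 0 = c by apply/funext => i; rewrite /p /h scale0r addr0.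
  by rewrite /phi p1 p0 scale1r scale0r subr0 addrAC.
apply: norm_increment_le => t t01 e e0.
have e'0 : 0 < e / (x + 1) by rewrite divr_gt0 // ltr_wpDl.
have [r r0 rP] := hd_approx_le k (dTP _ (Up t t01)) e'0.
exists (r / (x + 1)); first by rewrite divr_gt0 // ltr_wpDl.
move=> s s01 st.
have eqp : p t \+ (fun i => (s - t) *: h i) = p s.
  by apply/funext => i; rewrite /p /= -addrA -scalerDl [t + _]addrC subrK.
have := rP (fun i => (s - t) *: h i) (`|s - t| * x).
rewrite eqp (hd_scale (dTP _ (Up t t01))) => /(_ (Up s s01)) /(_ _)/wrap[].
  by move=> i; rewrite normrZ ler_wpM2l //; apply: hx.
move=> /(_ _)/wrap[].
  rewrite ler_pdivlMr ?ltr_wpDl // in st.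
  by apply: le_trans st; rewrite ler_wpM2l // lerDl.
move=> H; have Md := dM t t01.
have -> : phi s - phi t = (T (p s) k - T (p t) k - (s - t) *: dT (p t) h k)
     + (s - t) *: (dT (p t) h k - a).
  by rewrite /phi scalerBr addrA subrK scalerBl opprD addrACA -opprD.
apply: le_trans (ler_normD _ _) _; rewrite normrZ mulrDl addrC.
apply: lerD; first by rewrite mulrC ler_wpM2r.
apply: le_trans H _; rewrite mulrCA [leRHS]mulrC ler_wpM2l //.
rewrite mulrAC ler_pdivrMr ?ltr_wpDl // ler_wpM2l ?ltW //.
by rewrite ltrDl.
Qed.

(** The increments [s *: h] only have to be controlled for small [s], and the
    value [a] and the error [M] are free.  This covers the uniqueness of the
    differential, its action on constants, and its norm for a bounded operator. *)
Lemma differential_le (R : realType) (V : normedModType R) (U : set V)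
    (T : (int -> V) -> (int -> V)) c A h (k : int) (x M : R) (a : V) :
  has_differential U T c A -> (forall i, `|h i| <= x) ->
  (exists2 r, 0 < r & forall s, 0 < s -> s < r ->
     seq_in U (c \+ (fun i => s *: h i)) /\
     `|T (c \+ (fun i => s *: h i)) k - T c k - s *: a| <= s * M) ->
  `|A h k - a| <= M.
Proof.
move=> hA hx [r r0 rP]; apply/ler_addgt0Pr => e e0.
have x0 : 0 <= x by apply: le_trans (hx 0).
have x1 : 0 < x + 1 by rewrite ltr_wpDl.
have e'0 : 0 < e / (x + 1) by rewrite divr_gt0.
have [r' r'0 r'P] := hd_approx_le k hA e'0.
pose s := Num.min (r / 2) (r' / (x + 1)).
have s0 : 0 < s by rewrite lt_min !divr_gt0.
have sr : s < r by rewrite gt_min ltr_pdivrMr // ltr_pMr // ltr1n.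
have [Us sM] := rP s s0 sr.
have := r'P (fun i => s *: h i) (s * x) Us.
rewrite (hd_scale hA) => /(_ _)/wrap[].
  by move=> i; rewrite normrZ gtr0_norm // ler_wpM2l // ltW.
move=> /(_ _)/wrap[].
  have : s <= r' / (x + 1) by rewrite ge_min lexx orbT.
  rewrite ler_pdivlMr // => /(le_trans _); apply.
  by rewrite ler_wpM2l ?ltW // ltrDl.
move=> H; rewrite -(ler_pM2l s0) -[X in X * _](gtr0_norm s0) -normrZ.
have -> : s *: (A h k - a) =
   (T (c \+ (fun i => s *: h i)) k - T c k - s *: a) -
   (T (c \+ (fun i => s *: h i)) k - T c k - s *: A h k).
  by rewrite opprB [RHS]addrC subrKA scalerBr.
apply: le_trans (ler_normB _ _) _; rewrite mulrDr; apply: lerD => //.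
apply: le_trans H _; rewrite mulrCA ler_pM2l //.
by rewrite mulrAC ler_pdivrMr // ler_wpM2l ?ltW // ltrDl.
Qed.

(** * Linearization of local operators near constants *)

Lemma constant_perturbation_in (R : realType) (V : normedModType R) (U : set V)
    (p : V) (h : int -> V) (x : R) :
  open U -> U p -> (forall i, `|h i| <= x) ->
  exists2 r : R, 0 < r & forall s, 0 < s -> s < r ->
    seq_in U ((fun _ => p) \+ (fun i => s *: h i)).
Proof.
move=> Uo Up hx; have x0 : 0 <= x by apply: le_trans (hx 0).
have x1 : 0 < x + 1 by rewrite ltr_wpDl.
have /nbhs_ballP[r /= r0 rP] : nbhs p U by apply: open_nbhs_nbhs.
exists (r / (x + 1)); first by rewrite divr_gt0.
move=> s s0 sr i; apply: rP; rewrite -ball_normE /= opprD addrA subrr sub0r.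
rewrite normrN normrZ gtr0_norm //.
rewrite ltr_pdivlMr // in sr; apply: le_lt_trans sr.
apply: ler_wpM2l; first exact: ltW.
by apply: le_trans (hx i) _; rewrite lerDl.
Qed.

(** A differential at a constant sequence is determined on all bounded
    increments: since the domain is open, these are admissible once they are
    scaled down. *)
Lemma differential_const_unique (R : realType) (V : normedModType R)
    (U : set V) (T : (int -> V) -> (int -> V)) p A A' h (k : int) (x : R) :
  open U -> U p ->
  has_differential U T (fun _ => p) A -> has_differential U T (fun _ => p) A' ->
  (forall i, `|h i| <= x) -> A h k = A' h k.
Proof.
move=> Uo Up hA hA' hx; apply/eqP; rewrite -subr_eq0 -normr_le0.
apply/ler_addgt0Pr => e e0; rewrite add0r.
have x0 : 0 <= x by apply: le_trans (hx 0).
have x1 : 0 < x + 1 by rewrite ltr_wpDl.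
have [r r0 rP] := constant_perturbation_in Uo Up hx.
have e'0 : 0 < e / (x + 1) by rewrite divr_gt0.
have [r' r'0 r'P] := hd_approx_le k hA' e'0.
apply: (differential_le hA hx).
exists (Num.min r (r' / (x + 1))); first by rewrite lt_min r0 divr_gt0.
move=> s s0; rewrite lt_min => /andP[sr sr'].
have Us := rP s s0 sr; split=> //.
rewrite -(hd_scale hA').
apply: (@le_trans _ _ (e / (x + 1) * (s * x))).
  apply: r'P => //.
    by move=> i; rewrite normrZ gtr0_norm // ler_wpM2l // ltW.
  rewrite ltr_pdivlMr // in sr'; apply: le_trans (ltW sr').
  by rewrite ler_wpM2l ?ltW // ltrDl.
rewrite mulrCA ler_pM2l // mulrAC ler_pdivrMr // ler_wpM2l ?ltW //.
by rewrite ltrDl.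
Qed.

Lemma lipschitz_family_le (R : realType) (V : normedModType R) (U : set V)
    (dT : (int -> V) -> (int -> V) -> (int -> V)) (K : R) c c' h k (y x : R) :
  0 < K ->
  (supnorm (dT c h \- dT c' h) <= K%:E * supnorm (c \- c') * supnorm h)%E ->
  (forall i, `|c i - c' i| <= y) -> (forall i, `|h i| <= x) ->
  `|dT c h k - dT c' h k| <= K * y * x.
Proof.
move=> K0 dK cy hx; rewrite -lee_fin.
apply: (@le_trans _ _ (supnorm (dT c h \- dT c' h))).
  by apply: ereal_sup_ubound; exists k.
apply: le_trans dK _; rewrite !EFinM; apply: lee_pmul.
- by apply: mule_ge0; rewrite ?supnorm_ge0 // lee_fin ltW.
- exact: supnorm_ge0.
- apply: lee_wpmul2l; first by rewrite lee_fin ltW.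
  by apply/supnorm_leP.
- by apply/supnorm_leP.
Qed.

(** Replacing the data by constants outside of the window of entries on which
    [T _ k] depends makes them globally close to a constant sequence [p].  There
    the differential is [A], so the differential along the segment joining the
    data differs from [A] by a multiple of the oscillation [y]. *)
Lemma linearization_le (R : realType) (V : normedModType R) (U : set V)
    (T A : (int -> V) -> (int -> V)) dT (K : R) (k q : int) (w : nat)
    (c c' : int -> V) (x y : R) :
  open U -> convex_set U -> 0 < K ->
  (forall c0, seq_in U c0 -> has_differential U T c0 (dT c0)) ->
  (forall c0 c1 h, seq_in U c0 -> seq_in U c1 ->
     (supnorm (dT c0 h \- dT c1 h) <=
        K%:E * supnorm (c0 \- c1) * supnorm h)%E) ->
  (forall p, U p -> has_differential U T (fun _ => p) A) ->
  (forall c0 c1, seq_in U c0 -> seq_in U c1 ->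
     (forall l : int, `|l - q| <= w%:Z -> c0 l = c1 l) -> T c0 k = T c1 k) ->
  (forall h0 h1,
     (forall l : int, `|l - q| <= w%:Z -> h0 l = h1 l) -> A h0 k = A h1 k) ->
  seq_in U c -> seq_in U c' ->
  (forall l : int, `|l - q| <= w%:Z -> `|c l - c q| <= y) ->
  (forall l : int, `|l - q| <= w%:Z -> `|c' l - c' q| <= y) ->
  (forall l : int, `|l - q| <= w%:Z -> `|c' l - c l| <= x) ->
  `|T c' k - T c k - A (fun l => c' l - c l) k| <= K * y * x.
Proof.
move=> Uo Uc K0 dTP dTK TA locT locA Uc1 Uc2 cy c'y hx.
have qq : `|q - q| <= w%:Z by rewrite subrr normr0.
have y0 : 0 <= y by apply: le_trans (cy q qq).
have x0 : 0 <= x by apply: le_trans (hx q qq).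
pose tr (b : int -> V) l := if `|l - q| <= w%:Z then b l else b q.
have Utr b : seq_in U b -> seq_in U (tr b).
  by move=> Ub l; rewrite /tr; case: ifP.
have trE b l : `|l - q| <= w%:Z -> b l = tr b l by rewrite /tr => ->.
rewrite (locT c (tr c)) ?(locT c' (tr c')) //;
  try exact: Utr; try by move=> l; exact: trE.
rewrite (locA _ (fun l => tr c' l - tr c l)); last first.
  by move=> l lq; rewrite -!trE.
have hx' i : `|tr c' i - tr c i| <= x by rewrite /tr; case: ifP => iq; exact: hx.
apply: (op_increment_le Uc dTP _ _ hx'); try exact: Utr.
move=> t t01.
set ct := (fun i => tr c i + t *: _).
have Uct : seq_in U ct by apply: seq_in_segment => //; exact: Utr.
rewrite -(differential_const_unique k Uo (Uct q) (dTP _ _) (TA _ (Uct q)) hx');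
  last by move=> i; apply: Uct.
apply: (@lipschitz_family_le R V U dT) => //.
  by apply: dTK => // i; apply: Uct.
move=> i; have [t0 t1] := andP t01.
have ctE l : ct l = (1 - t) *: tr c l + t *: tr c' l.
  rewrite /ct scalerBl scale1r scalerBr -!addrA; congr (_ + _).
  by rewrite addrC.
rewrite !ctE opprD addrACA -!scalerBr.
apply: le_trans (ler_normD _ _) _; rewrite !normrZ !ger0_norm ?subr_ge0 //.
have -> : y = (1 - t) * y + t * y by ring.
rewrite {2 4}/tr qq /tr.
by apply: lerD; apply: ler_wpM2l; rewrite ?subr_ge0 //; case: ifP => iq;
  rewrite ?subrr ?normr0 //; auto.
Qed.

(** The data are compared with the constant sequence of their value at the
    center [q] of the window, which [T] reproduces.  The linear part contributes
    the first summand and the linearization error the second. *)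
Lemma near_constant_le (R : realType) (V : normedModType R) (U : set V)
    (T A : (int -> V) -> (int -> V)) dT (K a : R) (k q : int) (w : nat)
    (c : int -> V) (y : R) :
  open U -> convex_set U -> 0 < K ->
  (forall c0, seq_in U c0 -> has_differential U T c0 (dT c0)) ->
  (forall c0 c1 h, seq_in U c0 -> seq_in U c1 ->
     (supnorm (dT c0 h \- dT c1 h) <=
        K%:E * supnorm (c0 \- c1) * supnorm h)%E) ->
  (forall p, U p -> has_differential U T (fun _ => p) A) ->
  reproduces_constants U T ->
  (forall c0 c1, seq_in U c0 -> seq_in U c1 ->
     (forall l : int, `|l - q| <= w%:Z -> c0 l = c1 l) -> T c0 k = T c1 k) ->
  (forall h0 h1,
     (forall l : int, `|l - q| <= w%:Z -> h0 l = h1 l) -> A h0 k = A h1 k) ->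
  (forall h x, (forall l : int, `|l - q| <= w%:Z -> `|h l| <= x) ->
     `|A h k| <= a * x) ->
  seq_in U c -> (forall l : int, `|l - q| <= w%:Z -> `|c l - c q| <= y) ->
  `|T c k - c q| <= a * y + K * y * y.
Proof.
move=> Uo Uc K0 dTP dTK TA Tconst locT locA Aa Uc1 cy.
have qq : `|q - q| <= w%:Z by rewrite subrr normr0.
have y0 : 0 <= y by apply: le_trans (cy q qq).
have Uq : seq_in U (fun _ => c q) by move=> i; apply: Uc1.
have := linearization_le Uo Uc K0 dTP dTK TA locT locA Uq Uc1 _ cy cy.
rewrite Tconst // => /(_ _)/wrap[|H]; first by move=> l _; rewrite subrr normr0.
rewrite -[X in `|X|](subrK (A (fun l => c l - c q) k)).
apply: le_trans (ler_normD _ _) _; rewrite addrC; apply: lerD => //.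
exact: Aa.
Qed.

Lemma bounded_op_le (R : realType) (W : normedModType R)
    (T : (int -> W) -> (int -> W)) : bounded_op T ->
  exists2 C : R, 0 < C & forall w x, (forall i, `|w i| <= x) ->
    forall k, `|T w k| <= C * x.
Proof.
move=> [C C0 TC]; exists C => // w x wx; apply/supnorm_leP.
apply: le_trans (TC w) _; rewrite EFinM; apply: lee_wpmul2l.
  by rewrite lee_fin ltW.
by apply/supnorm_leP.
Qed.

(** Boundedness controls the differential at 0, and the Lipschitz property of
    the differential transfers this to bounded sets. *)
Lemma bounded_op_lipschitz (R : realType) (W : normedModType R)
    (T : (int -> W) -> (int -> W)) :
  bounded_op T -> C1_lipschitz setT T ->
  forall M : R, exists2 L : R, 0 < L & forall w w' x,
    (forall i, `|w i| <= M) -> (forall i, `|w' i| <= M) ->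
    (forall i, `|w' i - w i| <= x) -> forall k, `|T w' k - T w k| <= L * x.
Proof.
move=> /bounded_op_le[C C0 Tle] [dT [dTP [K K0 dTK]]] M.
have inT (b : int -> W) : seq_in [set: W] b by [].
have T0 k : T (fun _ => 0) k = 0.
  apply/eqP; rewrite -normr_le0 -(mulr0 C); apply: Tle => i.
  by rewrite normr0.
have cvT : convex_set [set: W] by move=> *; rewrite inE.
exists (C + K * Num.max M 0).
  by rewrite ltr_wpDr // mulr_ge0 ?(ltW K0) // le_max lexx orbT.
move=> w w' x wM w'M wx k; rewrite -[T w' k - _]subr0.
have M0 : 0 <= M by apply: le_trans (wM 0).
have x0 : 0 <= x by apply: le_trans (wx 0).
rewrite max_l //.
apply: (op_increment_le cvT dTP _ _ wx) => // t t01.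
set ct := (fun i => w i + _); set h := (fun i => w' i - w i).
rewrite subr0 -[dT ct h k](subrK (dT (fun _ => 0) h k)) addrC.
apply: le_trans (ler_normD _ _) _; rewrite mulrDl; apply: lerD.
  rewrite -[dT _ _ _]subr0; apply: (differential_le (dTP _ (inT _)) wx).
  exists 1 => // s s0 _; split=> //.
  rewrite T0 scaler0 !subr0 mulrCA; apply: Tle => i.
  rewrite /= add0r normrZ gtr0_norm // ler_wpM2l ?(ltW s0) //; exact: wx.
apply: (@lipschitz_family_le R W setT dT) => //; first exact: dTK.
move=> i; rewrite subr0 /ct; have [t0 t1] := andP t01.
have -> : w i + t *: (w' i - w i) = (1 - t) *: w i + t *: w' i.
  by rewrite scalerBl scale1r scalerBr -!addrA; congr (_ + _); rewrite addrC.
apply: le_trans (ler_normD _ _) _; rewrite !normrZ !ger0_norm ?subr_ge0 //.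
have -> : M = (1 - t) * M + t * M by ring.
by apply: lerD; apply: ler_wpM2l; rewrite ?subr_ge0.
Qed.

(** * Adding vectors to points *)

Lemma differentiable_approx (R : realType) (E F : normedModType R) (f : E -> F)
    (x : E) (e : R) : differentiable f x -> 0 < e ->
  exists2 r : R, 0 < r & forall h, `|h| <= r ->
    `|f (x + h) - f x - 'd f x h| <= e * `|h|.
Proof.
move=> /diff_locally/eqaddoP/(_ e) dfx e0.
have /nbhs_ballP[r /= r0 rP] := dfx e0.
exists (r / 2); first by rewrite divr_gt0.
move=> h hr; have := rP h; rewrite !fctE [h + x]addrC opprD addrA; apply.
rewrite -ball_normE /= sub0r normrN (le_lt_trans hr) //.
by rewrite ltr_pdivrMr // ltr_pMr // ltr1n.
Qed.

Lemma differential_norm_le (R : realType) (E F : normedModType R) (f : E -> F)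
    (dom : set E) (x : E) (K : R) : open dom -> dom x -> differentiable f x ->
  K.-lipschitz_dom f -> forall v, `|'d f x v| <= K * `|v|.
Proof.
move=> od dx dfx lip v; apply/ler_addgt0Pr => e e0.
have e'0 : 0 < e / (`|v| + 1) by rewrite divr_gt0 // ltr_wpDl.
have [r r0 rP] := differentiable_approx dfx e'0.
have /nbhs_ballP[r' /= r'0 r'P] : nbhs x dom by apply: open_nbhs_nbhs.
have v1 : 0 < `|v| + 1 by rewrite ltr_wpDl.
pose s := Num.min (r / (`|v| + 1)) (r' / 2 / (`|v| + 1)).
have s0 : 0 < s by rewrite lt_min !divr_gt0.
have sv b : s <= b / (`|v| + 1) -> `|s *: v| <= b.
  rewrite ler_pdivlMr // normrZ gtr0_norm // => /(le_trans _); apply.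
  by rewrite ler_pM2l // lerDl.
have svr : `|s *: v| <= r by apply: sv; rewrite ge_min lexx.
have svr' : `|s *: v| < r'.
  apply: (@le_lt_trans _ _ (r' / 2)); last by rewrite ltr_pdivrMr // ltr_pMr // ltr1n.
  by apply: sv; rewrite ge_min lexx orbT.
have dxs : dom (x + s *: v).
  by apply: r'P; rewrite -ball_normE /= opprD addrA subrr sub0r normrN.
have /= lipx := lip (x + s *: v, x) (conj dxs dx).
rewrite addrAC subrr add0r in lipx.
have /= ap := rP _ svr.
rewrite linearZ /= in ap.
rewrite -(ler_pM2l s0) -[X in X * `|_|](gtr0_norm s0) -normrZ.
rewrite -[X in `|X|](subKr (f (x + s *: v) - f x)).
apply: le_trans (ler_normB _ _) _; rewrite mulrDr; apply: lerD.
  by apply: le_trans lipx _; rewrite normrZ gtr0_norm // mulrCA.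
apply: le_trans ap _; rewrite normrZ gtr0_norm // mulrCA ler_pM2l //.
by rewrite mulrAC ler_pdivrMr // ler_pM2l // lerDl.
Qed.

(** Only the vector is moved along a segment, from 0 to its final value, so
    that only the star shape of the domain of [oplus] is needed.  At the vector
    0 both points are unchanged.  On the way the velocities are values of the
    differential at two points, applied to [v] and to [v']: changing the point
    costs a multiple of [`|v|], changing the vector a multiple of their
    distance. *)
Lemma oplus_increment_le (R : realType) (V W : normedModType R)
    (dom : set (V * W)) (oplus : V -> W -> V) (K L : R) (p p' : V) (v v' : W) :
  open dom ->
  (forall q u (t : R), dom (q, u) -> 0 <= t <= 1 -> dom (q, t *: u)) ->
  (forall x, dom x -> differentiable (fun x => oplus x.1 x.2) x) ->
  K.-lipschitz_dom (fun x => oplus x.1 x.2) -> 0 <= L ->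
  (forall x y u, dom x -> dom y ->
    `|'d (fun x => oplus x.1 x.2) x u - 'd (fun x => oplus x.1 x.2) y u|
      <= L * `|x - y| * `|u|) ->
  dom (p, v) -> dom (p', v') -> oplus p 0 = p -> oplus p' 0 = p' ->
  `|(oplus p v - oplus p' v') - (p - p')| <=
    L * (`|p - p'| + `|v - v'|) * `|v| + K * `|v - v'|.
Proof.
move=> od star df lip L0 dL dpv dpv' p0 p'0.
set F := (fun x : V * W => oplus x.1 x.2) in df lip dL.
pose phi t := F (p, t *: v) - F (p', t *: v').
have -> : (oplus p v - oplus p' v') - (p - p') = phi 1 - phi 0.
  by rewrite /phi /F /= !scale1r !scale0r p0 p'0.
apply: norm_increment_le => t t01 e e0.
have e20 : 0 < e / 2 by rewrite divr_gt0.
have dt : dom (p, t *: v) by apply: star.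
have dt' : dom (p', t *: v') by apply: star.
have v1 : 0 < `|v| + 1 by rewrite ltr_wpDl.
have v'1 : 0 < `|v'| + 1 by rewrite ltr_wpDl.
have ev0 : 0 < e / 2 / (`|v| + 1) by rewrite divr_gt0.
have ev'0 : 0 < e / 2 / (`|v'| + 1) by rewrite divr_gt0.
have [r r0 rP] := differentiable_approx (df _ dt) ev0.
have [r' r'0 r'P] := differentiable_approx (df _ dt') ev'0.
have norm_in2 (u : W) : `|(0 : V, u)| = `|u|.
  by rewrite prod_normE /= normr0 max_r.
exists (Num.min (r / (`|v| + 1)) (r' / (`|v'| + 1))).
  by rewrite lt_min !divr_gt0.
move=> s s01; rewrite le_min => /andP[sr sr'].
have sb (u : W) b : `|s - t| <= b / (`|u| + 1) -> `|(0 : V, (s - t) *: u)| <= b.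
  rewrite norm_in2 normrZ ler_pdivlMr ?ltr_wpDl // => /(le_trans _); apply.
  by rewrite ler_wpM2l // lerDl.
have move_s (q : V) (u : W) : (q, t *: u) + (0, (s - t) *: u) = (q, s *: u).
  by congr (_, _) => /=; rewrite ?addr0 // -scalerDl addrC subrK.
have := rP _ (sb _ _ sr); have := r'P _ (sb _ _ sr').
rewrite !move_s.
have dZ x u : 'd F x (0 : V, (s - t) *: u) = (s - t) *: 'd F x (0, u).
  rewrite -linearZ /=; congr ('d F x _).
  by congr (_, _) => //=; rewrite scaler0.
rewrite !dZ; set D := 'd F _ _; set D' := 'd F _ _ => a' a.
have -> : phi s - phi t = (F (p, s *: v) - F (p, t *: v) - (s - t) *: D') -
    (F (p', s *: v') - F (p', t *: v') - (s - t) *: D) + (s - t) *: (D' - D).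
  have swap (a1 a2 a3 a4 : V) : (a1 - a2) - (a3 - a4) = (a1 - a3) - (a2 - a4).
    by rewrite opprD addrACA -opprD.
  by rewrite /phi scalerBr swap [in RHS]swap subrK.
have Dle : `|D' - D| <= L * (`|p - p'| + `|v - v'|) * `|v| + K * `|v - v'|.
  have -> : D' - D = ('d F (p, t *: v) (0, v) - 'd F (p', t *: v') (0, v))
       + 'd F (p', t *: v') (0, v - v').
    have -> : (0 : V, v - v') = (0, v) - (0, v').
      by congr (_, _) => /=; rewrite subr0.
    by rewrite linearB /= subrKA.
  apply: le_trans (ler_normD _ _) _; apply: lerD.
    apply: le_trans (dL _ _ _ dt dt') _; rewrite norm_in2 ler_wpM2r //.
    apply: ler_wpM2l => //; rewrite prod_normE /= -scalerBr normrZ ge_max.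
    rewrite lerDl normr_ge0 /= (le_trans _ (ler_wpDl _ (lexx _))) //.
    by rewrite ger0_norm ?ler_piMl //; case/andP: t01.
  rewrite -(norm_in2 (v - v')).
  exact: (differential_norm_le od dt' (df _ dt') lip).
have half (u : W) : e / 2 / (`|u| + 1) * `|(0 : V, (s - t) *: u)|
    <= e / 2 * `|s - t|.
  rewrite norm_in2 normrZ mulrCA mulrC ler_wpM2r // mulrAC.
  by rewrite ler_pdivrMr ?ltr_wpDl // ler_pM2l // lerDl.
apply: le_trans (ler_normD _ _) _; rewrite mulrDl addrC; apply: lerD.
  by rewrite normrZ mulrC ler_wpM2r.
apply: le_trans (ler_normB _ _) _.
apply: le_trans (lerD (le_trans a (half v)) (le_trans a' (half v'))) _; lra.
Qed.

(** * Linear upscaling and downscaling as finite sums *)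

Lemma fsum_window (V : zmodType) (F : int -> V) (q : int) (w : nat) :
  (forall l : int, w%:Z < `|l - q| -> F l = 0) ->
  \sum_(l \in [set: int]) F l = \sum_(i < w.*2.+1) F (q - w%:Z + i%:Z).
Proof.
move=> F0; pose r := [seq q - w%:Z + i%:Z | i <- iota 0 w.*2.+1].
rewrite (fsbigE r) //.
- rewrite big_mkcond /= big_map -[iota _ _]/(index_iota 0 w.*2.+1) big_mkord.
  by apply: eq_bigr => i _; rewrite in_setT.
- rewrite map_inj_uniq ?iota_uniq // => i j /=; lia.
move=> l _ lr; apply: F0; apply: contraR lr; rewrite -leNgt => lq.
apply/mapP; exists (absz (l - q + w%:Z)); first by rewrite mem_iota; lia.
lia.
Qed.

Lemma norm_window_sum_le (R : realType) (V : normedModType R) (m : nat)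
    (a : 'I_m -> R) (v : 'I_m -> V) (M x : R) :
  0 <= M -> (forall i, `|a i| <= M) -> (forall i, `|v i| <= x) ->
  `|\sum_(i < m) a i *: v i| <= m%:R * M * x.
Proof.
move=> M0 aM vx; apply: le_trans (ler_norm_sum _ _ _) _.
rewrite -mulrA mulr_natl -[X in _ *+ X](card_ord m) -sumr_const.
apply: ler_sum => i _; rewrite normrZ; exact: ler_pM.
Qed.

Lemma finitely_supported_bounded (R : realType) (a : int -> R) :
  finitely_supported a -> exists2 M : R, 0 <= M & forall i, `|a i| <= M.
Proof.
move=> [n an]; exists (\sum_(i < n.*2.+1) `|a (- n%:Z + i%:Z)|).
  by apply: sumr_ge0.
move=> l; have [ln|nl] := leP `|l| n%:Z; last by rewrite an // normr0 sumr_ge0.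
have ln' : (absz (l + n%:Z)%R < n.*2.+1)%N by lia.
rewrite (bigD1 (Ordinal ln')) //= ler_wpDr ?sumr_ge0 //.
by rewrite (_ : - n%:Z + _ = l) //; lia.
Qed.

Lemma SlinE (R : realType) (V : normedModType R) (alpha : int -> R) (n : nat)
    (c : int -> V) (k q : int) (w : nat) :
  (forall i : int, n%:Z < `|i| -> alpha i = 0) ->
  (forall l : int, `|k - 2 * l| <= n%:Z -> `|l - q| <= w%:Z) ->
  Slin alpha c k = \sum_(i < w.*2.+1)
    alpha (k - 2 * (q - w%:Z + i%:Z)) *: c (q - w%:Z + i%:Z).
Proof.
move=> alpha0 kq; apply: fsum_window => l lq.
rewrite alpha0 ?scale0r // ltNge; apply/negP => /kq; lia.
Qed.

Lemma DlinE (R : realType) (V : normedModType R) (beta : int -> R) (n : nat)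
    (c : int -> V) (k : int) :
  (forall i : int, n%:Z < `|i| -> beta i = 0) ->
  Dlin beta c k = \sum_(i < n.*2.+1)
    beta (2 * k - n%:Z + i%:Z - 2 * k) *: c (2 * k - n%:Z + i%:Z).
Proof.
move=> beta0; apply: fsum_window => l lq.
by rewrite beta0 ?scale0r //; lia.
Qed.

(** One more than the length of the filter is needed on either side because the
    center [k / 2] is rounded down. *)
Lemma half_window (n : nat) (k l : int) :
  `|k - 2 * l| <= n%:Z -> `|l - (k %/ 2)%Z| <= n.+1%:Z.
Proof. lia. Qed.

Lemma Slin_local (R : realType) (V : normedModType R) (alpha : int -> R)
    (n : nat) (c c' : int -> V) (k : int) :
  (forall i : int, n%:Z < `|i| -> alpha i = 0) ->
  (forall l : int, `|k - 2 * l| <= n%:Z -> c l = c' l) ->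
  Slin alpha c k = Slin alpha c' k.
Proof.
move=> alpha0 cc'; apply: eq_fsbigr => l _.
have [kl|kl] := leP `|k - 2 * l| n%:Z; first by rewrite cc'.
by rewrite alpha0 // !scale0r.
Qed.

Lemma Slin_translate (R : realType) (V : normedModType R) (alpha : int -> R)
    (n : nat) (c : int -> V) (a k : int) :
  (forall i : int, n%:Z < `|i| -> alpha i = 0) ->
  Slin alpha (fun l => c (l - a)) k = Slin alpha c (k - 2 * a).
Proof.
move=> alpha0; rewrite (SlinE _ alpha0 (@half_window n k)).
rewrite (@SlinE _ _ _ _ _ _ ((k %/ 2)%Z - a) n.+1 alpha0); last by move=> l; lia.
by apply: eq_bigr => i _; congr (alpha _ *: c _); lia.
Qed.

Lemma Slin_scale (R : realType) (V : normedModType R) (alpha : int -> R)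
    (n : nat) (b : int -> R^o) (v : V) (k : int) :
  (forall i : int, n%:Z < `|i| -> alpha i = 0) ->
  Slin alpha (fun l => b l *: v) k = Slin alpha b k *: v.
Proof.
move=> alpha0; rewrite !(SlinE _ alpha0 (@half_window n k)) scaler_suml.
by apply: eq_bigr => i _; rewrite scalerA.
Qed.

Lemma Slin_sum (R : realType) (V : normedModType R) (alpha : int -> R)
    (n m : nat) (b : 'I_m -> int -> V) (k : int) :
  (forall i : int, n%:Z < `|i| -> alpha i = 0) ->
  Slin alpha (fun l => \sum_(i < m) b i l) k = \sum_(i < m) Slin alpha (b i) k.
Proof.
move=> alpha0; rewrite (SlinE _ alpha0 (@half_window n k)).
under [RHS]eq_bigr do rewrite (SlinE _ alpha0 (@half_window n k)).
by rewrite exchange_big; apply: eq_bigr => i _; rewrite scaler_sumr.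
Qed.

Lemma Slin_linear (R : realType) (V : normedModType R) (alpha : int -> R)
    (n : nat) (a : R) (c c' : int -> V) (k : int) :
  (forall i : int, n%:Z < `|i| -> alpha i = 0) ->
  Slin alpha (fun l => a *: c l + c' l) k = a *: Slin alpha c k + Slin alpha c' k.
Proof.
move=> alpha0; rewrite !(SlinE _ alpha0 (@half_window n k)) scaler_sumr -big_split.
by apply: eq_bigr => i _; rewrite scalerDr !scalerA mulrC.
Qed.

Lemma Slin_norm_le (R : realType) (V : normedModType R) (alpha : int -> R)
    (n : nat) (M : R) (c : int -> V) (x : R) (k : int) :
  (forall i : int, n%:Z < `|i| -> alpha i = 0) ->
  (forall i, `|alpha i| <= M) ->
  (forall l : int, `|l - (k %/ 2)%Z| <= n.+1%:Z -> `|c l| <= x) ->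
  `|Slin alpha c k| <= (n.+1).*2.+1%:R * M * x.
Proof.
move=> alpha0 aM cx; rewrite (SlinE _ alpha0 (@half_window n k)).
have M0 : 0 <= M by apply: le_trans (aM 0).
apply: norm_window_sum_le => // i; apply: cx; have := ltn_ord i; lia.
Qed.

Lemma Dlin_local (R : realType) (V : normedModType R) (beta : int -> R)
    (n : nat) (c c' : int -> V) (k : int) :
  (forall i : int, n%:Z < `|i| -> beta i = 0) ->
  (forall l : int, `|l - 2 * k| <= n%:Z -> c l = c' l) ->
  Dlin beta c k = Dlin beta c' k.
Proof.
move=> beta0 cc'; apply: eq_fsbigr => l _.
have [kl|kl] := leP `|l - 2 * k| n%:Z; first by rewrite cc'.
by rewrite beta0 // !scale0r.
Qed.

Lemma Dlin_norm_le (R : realType) (V : normedModType R) (beta : int -> R)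
    (n : nat) (M : R) (c : int -> V) (x : R) (k : int) :
  (forall i : int, n%:Z < `|i| -> beta i = 0) ->
  (forall i, `|beta i| <= M) ->
  (forall l : int, `|l - 2 * k| <= n%:Z -> `|c l| <= x) ->
  `|Dlin beta c k| <= n.*2.+1%:R * M * x.
Proof.
move=> beta0 bM cx; rewrite (DlinE _ _ beta0).
have M0 : 0 <= M by apply: le_trans (bM 0).
apply: norm_window_sum_le => // i; apply: cx; have := ltn_ord i; lia.
Qed.

(** * Iterates of the linear rule *)

(** The scalars are taken as a module over themselves, so that the linear rule
    applies to scalar sequences too. *)
Definition delta (R : realType) : int -> R^o := fun l => if l == 0 then 1 else 0.

(** The radius of dependence, measured in entries of the output, satisfies the
    recursion [r' = 2 * r + n]; its solution is [n * (2 ^+ j - 1)]. *)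
Lemma iter_Slin_local (R : realType) (V : normedModType R) (alpha : int -> R)
    (n : nat) (j : nat) (c c' : int -> V) (k : int) :
  (forall i : int, n%:Z < `|i| -> alpha i = 0) ->
  (forall l : int, `|k - 2 ^+ j * l| <= n%:Z * (2 ^+ j - 1) -> c l = c' l) ->
  iter j (Slin alpha) c k = iter j (Slin alpha) c' k.
Proof.
move=> alpha0; elim: j k => [|j IH] k cc' /=.
  by apply: cc'; rewrite expr0; lia.
apply: (Slin_local alpha0) => l kl; apply: IH => i li; apply: cc'.
rewrite exprS; set B := 2 ^+ j in li *; lia.
Qed.

Lemma iter_Slin_translate (R : realType) (V : normedModType R)
    (alpha : int -> R) (n : nat) (j : nat) (c : int -> V) (a k : int) :
  (forall i : int, n%:Z < `|i| -> alpha i = 0) ->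
  iter j (Slin alpha) (fun l => c (l - a)) k =
  iter j (Slin alpha) c (k - 2 ^+ j * a).
Proof.
move=> alpha0; elim: j k => [|j IH] k /=; first by rewrite expr0 mul1r.
rewrite (_ : iter j _ _ = fun l => iter j (Slin alpha) c (l - 2 ^+ j * a));
  last by apply/funext => l; apply: IH.
by rewrite (Slin_translate _ _ _ alpha0) exprS -mulrA.
Qed.

Lemma iter_Slin_scale (R : realType) (V : normedModType R) (alpha : int -> R)
    (n : nat) (j : nat) (b : int -> R^o) (v : V) (k : int) :
  (forall i : int, n%:Z < `|i| -> alpha i = 0) ->
  iter j (Slin alpha) (fun l => b l *: v) k = iter j (Slin alpha) b k *: v.
Proof.
move=> alpha0; elim: j k => [//|j IH] k /=.
rewrite -(Slin_scale _ _ _ alpha0); congr (Slin alpha _ k).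
exact/funext.
Qed.

Lemma iter_Slin_sum (R : realType) (V : normedModType R) (alpha : int -> R)
    (n m : nat) (j : nat) (b : 'I_m -> int -> V) (k : int) :
  (forall i : int, n%:Z < `|i| -> alpha i = 0) ->
  iter j (Slin alpha) (fun l => \sum_(i < m) b i l) k =
  \sum_(i < m) iter j (Slin alpha) (b i) k.
Proof.
move=> alpha0; elim: j k => [//|j IH] k /=.
rewrite -(Slin_sum _ _ alpha0); congr (Slin alpha _ k).
exact/funext.
Qed.

Lemma iter_Slin_linear (R : realType) (V : normedModType R) (alpha : int -> R)
    (n : nat) (j : nat) (a : R) (c c' : int -> V) (k : int) :
  (forall i : int, n%:Z < `|i| -> alpha i = 0) ->
  iter j (Slin alpha) (fun l => a *: c l + c' l) k =
  a *: iter j (Slin alpha) c k + iter j (Slin alpha) c' k.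
Proof.
move=> alpha0; elim: j k => [//|j IH] k /=.
rewrite -(Slin_linear _ _ _ _ alpha0); congr (Slin alpha _ k).
exact/funext.
Qed.

Lemma iter_Slin0 (R : realType) (V : normedModType R) (alpha : int -> R)
    (n : nat) (j : nat) (k : int) :
  (forall i : int, n%:Z < `|i| -> alpha i = 0) ->
  iter j (Slin alpha) (fun _ => 0 : V) k = 0.
Proof.
move=> alpha0; have := iter_Slin_linear j (-1) (fun _ => 0 : V) (fun _ => 0) k alpha0.
move=> H; apply: etrans (etrans H _); last by rewrite [LHS]addrC scaleN1r subrr.
congr (iter j _ _ k).
by apply/funext => i; rewrite scaler0 addr0.
Qed.

(** The iterates are convolutions with the iterates of the delta sequence, and
    the number of contributing coefficients does not depend on [j]. *)
Lemma iter_Slin_convolution (R : realType) (V : normedModType R)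
    (alpha : int -> R) (n : nat) (j : nat) (c : int -> V) (k q : int) (w : nat) :
  (forall i : int, n%:Z < `|i| -> alpha i = 0) ->
  (forall l : int, `|k - 2 ^+ j * l| <= n%:Z * (2 ^+ j - 1) ->
     `|l - q| <= w%:Z) ->
  iter j (Slin alpha) c k = \sum_(i < w.*2.+1)
    iter j (Slin alpha) (@delta R) (k - 2 ^+ j * (q - w%:Z + i%:Z))
      *: c (q - w%:Z + i%:Z).
Proof.
move=> alpha0 kq.
pose b (i : 'I_w.*2.+1) l := delta R (l - (q - w%:Z + i%:Z)) *: c (q - w%:Z + i%:Z).
rewrite (@iter_Slin_local _ _ _ n _ _ (fun l => \sum_(i < w.*2.+1) b i l)) //.
  rewrite (iter_Slin_sum _ _ _ alpha0); apply: eq_bigr => i _.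
  by rewrite (iter_Slin_scale _ _ _ _ alpha0) (iter_Slin_translate _ _ _ _ alpha0).
move=> l /kq lq.
have lw : (absz (l - q + w%:Z)%R < w.*2.+1)%N by lia.
have lE : q - w%:Z + (absz (l - q + w%:Z)%R)%:Z = l by lia.
rewrite (bigD1 (Ordinal lw)) //= big1 ?addr0 => [|i il].
  by rewrite /b lE /delta /= subrr eqxx scale1r.
rewrite /b /delta ifF ?scale0r //; apply/negbTE; apply: contraNneq il => li.
by apply/eqP/val_inj => /=; lia.
Qed.

Lemma iter_delta_support (R : realType) (alpha : int -> R) (n j : nat)
    (k : int) :
  (forall i : int, n%:Z < `|i| -> alpha i = 0) ->
  n%:Z * 2 ^+ j < `|k| -> iter j (Slin alpha) (@delta R) k = 0.
Proof.
move=> alpha0 kn; rewrite -[RHS](@iter_Slin0 _ R^o alpha n j k alpha0).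
apply: (iter_Slin_local alpha0) => l kl; rewrite /delta ifF //.
by apply/negbTE; apply: contraTneq kl => ->; lia.
Qed.

Lemma pow2_window (n j : nat) (k l q : int) :
  2 ^+ j * q <= k -> k <= 2 ^+ j * (q + 1) ->
  `|k - 2 ^+ j * l| <= n%:Z * (2 ^+ j - 1) -> `|l - q| <= n.+1%:Z.
Proof.
have B0 : 0 < 2 ^+ j :> int by rewrite exprn_gt0.
set B := 2 ^+ j in B0 *; move=> qk kq kl.
have : B * `|l - q| <= B * n.+1%:Z by rewrite -[X in X * `|_|]gtr0_norm // -normrM; nia.
by rewrite ler_pM2l.
Qed.

Lemma delta_norm_le (R : realType) (l : int) : `|delta R l| <= 1.
Proof. by rewrite /delta; case: ifP; rewrite ?normr1 ?normr0. Qed.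

(** * Consequences of convergence *)

Lemma continuous_segment_unif (R : realType) (V : normedModType R) (f : R -> V)
    (N e : R) : continuous f -> 0 < e -> exists2 r : R, 0 < r &
  forall x y, - N <= x <= N -> `|x - y| <= r -> `|f x - f y| <= e.
Proof.
move=> fc e0; have e20 : 0 < e / 2 by rewrite divr_gt0.
have := @segment_compact R (- N) N => /compact_near_coveringP.
move=> /(_ _ 0^'+ (fun (r x : R) => forall y,
  `|x - y| <= r -> `|f x - f y| <= e)) /(_ (within_filter _ _)).
move=> /(_ _)/wrap[|].
  move=> x _; have /cvgrPdist_le/(_ _ e20)/nbhs_ballP[d /= d0 dP] := fc x.
  have d20 : 0 < d / 2 by rewrite divr_gt0.
  exists (ball x (d / 2), [set r : R | 0 < r < d / 2]) => /=.
    split; first exact: nbhsx_ballx.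
    by near=> r; apply/andP; split; near: r;
      [exact: nbhs_right_gt|exact: nbhs_right_lt].
  move=> [x' r] /= [+ /andP[r0 rd]] y x'y; rewrite -ball_normE /= => xx'.
  have fx' : `|f x - f x'| <= e / 2.
    apply: dP; rewrite -ball_normE /= (lt_trans xx') //.
    by rewrite ltr_pdivrMr // ltr_pMr // ltr1n.
  have fy : `|f x - f y| <= e / 2.
    apply: dP; rewrite -ball_normE /= (splitr d).
    rewrite -(subrKA x'); apply: le_lt_trans (ler_normD _ _) _.
    by apply: ltrD => //; apply: le_lt_trans rd.
  rewrite -(subrKA (f x)); apply: le_trans (ler_normD _ _) _.
  by rewrite [e]splitr; apply: lerD => //; rewrite distrC.
move=> unif.
have : \forall r \near 0^'+, 0 < r /\ (forall x, `[- N, N]%classic x ->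
    forall y, `|x - y| <= r -> `|f x - f y| <= e).
  near=> r; split; near: r; first exact: nbhs_right_gt.
  exact: unif.
case/filter_ex => r [r0 rP]; exists r => // x y xN; apply: rP.
by rewrite /= in_itv.
Unshelve. all: by end_near. Qed.

Lemma continuous_segment_bounded (R : realType) (V : normedModType R)
    (f : R -> V) (N : R) : continuous f -> exists B : R,
  forall x, - N <= x <= N -> `|f x| <= B.
Proof.
move=> fc; have := continuous_compact _ (@segment_compact R (- N) N).
move=> /(_ V f)/(_ _)/wrap[|]; first exact: continuous_subspaceT.
move=> /compact_bounded[B [_ BP]]; exists (B + 1) => x xN.
apply: (BP (B + 1)); first by rewrite ltrDl.
by exists x => //=; rewrite in_itv.
Qed.

Lemma pow2_unbounded (R : realType) (x : R) : exists J : nat, forall j, (J <= j)%N ->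
  x <= 2 ^+ j.
Proof.
exists (Num.truncn `|x|).+1 => j Jj.
apply: (le_trans (ler_norm x)); apply: (le_trans (ltW (truncnS_gt _))).
rewrite -natrX ler_nat; apply: leq_trans Jj _.
by apply: ltnW; apply: ltn_expl.
Qed.

(** The iterates of the delta sequence follow the samples of a continuous limit
    function over a fixed interval, so they inherit its boundedness and its
    uniform continuity.  Both properties are uniform over the data, because the
    delta sequence generates all of them. *)
Lemma convergent_delta (R : realType) (V : normedModType R) (alpha : int -> R)
    (n : nat) :
  (forall i : int, n%:Z < `|i| -> alpha i = 0) ->
  convergent_subdivision (Slin alpha : (int -> V) -> (int -> V)) ->
  (exists2 M : R, 0 <= M & forall j k, `|iter j (Slin alpha) (@delta R) k| <= M)
  /\ (forall e : R, 0 < e -> exists J : nat, forall j k, (J <= j)%N ->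
        `|iter j (Slin alpha) (@delta R) (k + 1) -
          iter j (Slin alpha) (@delta R) k| <= e).
Proof.
move=> alpha0 [conv [c0 [f0 [c0b f0lim [x0 fx0]]]]].
set a := fun j => iter j (Slin alpha) (@delta R).
set v := f0 x0 in fx0.
have v0 : 0 < `|v| by rewrite normr_gt0.
have [f [fc flim]] : exists f, subdivision_limit
    (Slin alpha : (int -> V) -> (int -> V)) (fun l => delta R l *: v) f.
  apply: conv; apply: (@le_lt_trans _ _ (`|v|)%:E); last exact: ltry.
  by apply/supnorm_leP => l; rewrite normrZ ler_piMl ?delta_norm_le.
have close e : 0 < e -> exists J : nat, forall j k, (J <= j)%N ->
    `|a j k *: v - f (k%:~R / 2 ^+ j)| <= e.
  move=> e0.
  have : \forall j \near \oo, (supnorm (fun k : int => iter j (Slin alpha)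
     (fun l => delta R l *: v) k - f (k%:~R / 2 ^+ j))%R <= e%:E)%E.
    have : nbhs (0 : \bar R)%E [set x : \bar R | (x <= e%:E)%E].
      exists e => //= y /=; rewrite sub0r normrN lee_fin => /ltW.
      exact: le_trans (ler_norm _).
    exact: flim.
  case=> J _ JP; exists J => j k Jj; have /supnorm_leP/(_ k) := JP j Jj.
  by rewrite (iter_Slin_scale _ _ _ _ alpha0).
pose N : R := n%:R + 1.
have dyadic j k : `|k| <= n%:Z * 2 ^+ j ->
    `|k%:~R| / 2 ^+ j <= n%:R :> R.
  move=> kn; rewrite ler_pdivrMr ?exprn_gt0 // -intr_norm.
  rewrite -[n%:R]/(n%:Z%:~R) -[2 ^+ j](rmorphXn (intmul 1) j 2) -intrM ler_int.
  exact: kn.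
split.
  have [J1 J1P] := close 1 ltr01.
  have [B BP] := continuous_segment_bounded N fc.
  have [A A0 AP] : exists2 A : R, 1 <= A & forall j k, `|a j k| <= A ^+ j.
    have [M M0 MP] : exists2 M : R, 0 <= M & forall i, `|alpha i| <= M.
      by apply: finitely_supported_bounded; exists n.
    exists (1 + (n.+1).*2.+1%:R * M); first by rewrite lerDl mulr_ge0.
    elim=> [|j IH] k; first by rewrite expr0 delta_norm_le.
    rewrite exprS; apply: le_trans (Slin_norm_le alpha0 MP (fun l _ => IH l)) _.
    apply: ler_wpM2r; last by rewrite lerDr.
    by rewrite exprn_ge0 // addr_ge0 // mulr_ge0.
  have A00 : 0 <= A by apply: le_trans A0.
  have B0 : 0 <= (1 + `|B|) / `|v| by rewrite divr_ge0 // addr_ge0.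
  exists (A ^+ J1 + (1 + `|B|) / `|v|); first by rewrite addr_ge0 ?exprn_ge0.
  move=> j k; have [jJ|Jj] := leqP j J1.
    apply: le_trans (AP j k) _; rewrite ler_wpDr //; exact: ler_weXn2l.
  have [kn|kn] := leP `|k| (n%:Z * 2 ^+ j); last first.
    rewrite (iter_delta_support alpha0 kn) normr0.
    by rewrite addr_ge0 ?exprn_ge0.
  rewrite ler_wpDl ?exprn_ge0 // ler_pdivlMr // -normrZ.
  rewrite -[_ *: v](subrK (f (k%:~R / 2 ^+ j))).
  apply: le_trans (ler_normD _ _) _; apply: lerD; first exact/J1P/ltnW.
  apply: le_trans (ler_norm B); apply: BP; rewrite -ler_norml.
  rewrite normrM [X in _ * X]gtr0_norm ?invr_gt0 ?exprn_gt0 //.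
  by apply: le_trans (dyadic _ _ kn) _; rewrite lerDl.
move=> e e0; have e30 : 0 < e * `|v| / 3 by rewrite divr_gt0 // mulr_gt0.
have [J1 J1P] := close _ e30.
have [r r0 rP] := continuous_segment_unif N fc e30.
have [J2 J2P] := pow2_unbounded r^-1.
exists (maxn J1 J2) => j k; rewrite geq_max => /andP[jJ1 jJ2].
have p0 : 0 < 2 ^+ j :> R by rewrite exprn_gt0.
have p1 : 1 <= 2 ^+ j :> R by rewrite exprn_ege1 // ler1n.
have [kn|kn] := leP `|k| (n%:Z * 2 ^+ j + 1); last first.
  rewrite !(iter_delta_support alpha0) ?subrr ?normr0 ?(ltW e0) //; lia.
rewrite -(ler_pM2r v0) -normrZ scalerBl.
pose u : R := k%:~R / 2 ^+ j; pose u' : R := (k + 1)%:~R / 2 ^+ j.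
have uu' : `|u - u'| <= r.
  rewrite /u /u' intrD -mulrBl opprD addrA subrr sub0r mulN1r normrN.
  rewrite gtr0_norm ?invr_gt0 // -[r]invrK lef_pV2 ?posrE ?invr_gt0 //.
  exact: J2P.
have uN : - N <= u <= N.
  rewrite -ler_norml /u normrM [X in _ * X]gtr0_norm ?invr_gt0 //.
  rewrite ler_pdivrMr // -intr_norm.
  have : `|k|%:~R <= (n%:Z * 2 ^+ j + 1)%:~R :> R by rewrite ler_int.
  move=> /le_trans; apply; rewrite intrD intrM /N mulrDl mul1r.
  by apply: lerD => //; rewrite rmorphXn.
have -> : a j (k + 1) *: v - a j k *: v = (a j (k + 1) *: v - f u') -
    (a j k *: v - f u) - (f u - f u').
  have swap (x y z t : V) : (x - y) - (z - t) = (x - z) - (y - t).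
    by rewrite opprD addrACA -opprD.
  by rewrite -[f u - f u']opprB opprK [in RHS]swap subrK.
have := J1P j (k + 1) jJ1; have := J1P j k jJ1; have := rP _ _ uN uu'.
move=> h1 h2 h3; apply: le_trans (ler_normB _ _) _.
apply: le_trans (lerD (ler_normB _ _) h1) _.
by apply: le_trans (lerD (lerD h3 h2) (lexx _)) _; lra.
Qed.

Lemma oscillation_le (R : realType) (V : normedModType R) (c : int -> V) (y : R) :
  (forall i, `|Delta c i| <= y) ->
  forall (w : nat) (l q : int), `|l - q| <= w%:Z -> `|c l - c q| <= w%:R * y.
Proof.
move=> cy; have y0 : 0 <= y by apply: le_trans (cy 0).
have up (m : nat) q : `|c (q + m%:Z) - c q| <= m%:R * y.
  elim: m => [|m IH]; first by rewrite addr0 subrr normr0 mul0r.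
  rewrite (_ : q + m.+1%:Z = q + m%:Z + 1); last by lia.
  rewrite -(subrKA (c (q + m%:Z))); apply: le_trans (ler_normD _ _) _.
  by rewrite -natr1 mulrDl mul1r addrC; apply: lerD => //; exact: cy.
move=> w l q lq.
apply: (@le_trans _ _ ((absz (l - q)%R)%:R * y)); last first.
  by rewrite ler_wpM2r // ler_nat; lia.
have [ql|lq'] := leP q l.
  by have := up (absz (l - q)%R) q; rewrite (_ : q + _ = l) //; lia.
by rewrite distrC; have := up (absz (l - q)%R) l; rewrite (_ : l + _ = q) //; lia.
Qed.

Lemma pow2_floor (j : nat) (k : int) : exists q : int,
  2 ^+ j * q <= k /\ k + 1 <= 2 ^+ j * (q + 1).
Proof.
have B0 : 0 < 2 ^+ j :> int by rewrite exprn_gt0.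
set B := 2 ^+ j in B0 *.
exists (k %/ B)%Z; have := divz_eq k B; have := ltz_pmod k B0.
have := modz_ge0 k (lt0r_neq0 B0); set r := (k %% B)%Z; set q := (k %/ B)%Z.
by move=> ? ? ->; split; nia.
Qed.

(** Constants are reproduced, so only the oscillation of the data in the window
    enters, and the smoothness of the iterated delta sequence makes the result
    vary slowly. *)
Lemma Delta_iter_Slin_le (R : realType) (V : normedModType R)
    (alpha : int -> R) (n j : nat) (c : int -> V) (y e : R) (k : int) :
  (forall i : int, n%:Z < `|i| -> alpha i = 0) ->
  (forall (u : V) k, Slin alpha (fun _ => u) k = u) ->
  0 <= e ->
  (forall k, `|iter j (Slin alpha) (@delta R) (k + 1) -
     iter j (Slin alpha) (@delta R) k| <= e) ->
  (forall i, `|Delta c i| <= y) ->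
  `|Delta (iter j (Slin alpha) c) k| <= (n.+1).*2.+1%:R * e * (n.+1%:R * y).
Proof.
move=> alpha0 consts e0 ae cy; have [q [qk kq]] := pow2_floor j k.
have iterc : iter j (Slin alpha) (fun _ => c q) = (fun _ => c q).
  by elim: j {ae qk kq} => [//|j IH] /=; rewrite IH; apply/funext => l; exact: consts.
have rep l : iter j (Slin alpha) c l =
    iter j (Slin alpha) (fun i => c i - c q) l + c q.
  have := iter_Slin_linear j 1 (fun i => c i - c q) (fun _ => c q) l alpha0.
  rewrite iterc scale1r => <-; congr (iter j _ _ l).
  by apply/funext => i; rewrite scale1r subrK.
rewrite /Delta !rep opprD addrACA subrr addr0.
rewrite !(@iter_Slin_convolution _ _ _ n _ _ _ q n.+1) //.
- rewrite -sumrB; under eq_bigr do rewrite -scalerBl.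
  apply: norm_window_sum_le => // i.
    set t := q - _ + _; rewrite (_ : k + 1 - _ = k - 2 ^+ j * t + 1) //.
    by rewrite addrAC.
  by apply: oscillation_le => //; have := ltn_ord i; lia.
- by move=> l; apply: pow2_window => //; lia.
- by move=> l; apply: pow2_window => //; lia.
Qed.

Lemma iter_Slin_norm_le (R : realType) (V : normedModType R)
    (alpha : int -> R) (n j : nat) (c : int -> V) (x M : R) (k : int) :
  (forall i : int, n%:Z < `|i| -> alpha i = 0) -> 0 <= M ->
  (forall k, `|iter j (Slin alpha) (@delta R) k| <= M) ->
  (forall i, `|c i| <= x) ->
  `|iter j (Slin alpha) c k| <= (n.+1).*2.+1%:R * M * x.
Proof.
move=> alpha0 M0 aM cx; have [q [qk kq]] := pow2_floor j k.
rewrite (@iter_Slin_convolution _ _ _ n _ _ _ q n.+1) //.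
  exact: norm_window_sum_le.
by move=> l; apply: pow2_window => //; lia.
Qed.

(** A convergent rule which reproduces constants is power bounded, and its
    differences decay geometrically: once some iterate halves the size of
    differences, repeating it gives a geometric rate. *)
Lemma convergent_contractive (R : realType) (V : normedModType R)
    (alpha : int -> R) :
  finitely_supported alpha ->
  (forall (u : V) k, Slin alpha (fun _ => u) k = u) ->
  convergent_subdivision (Slin alpha : (int -> V) -> (int -> V)) ->
  exists M g : R, [/\ 1 <= M, 0 < g, g < 1 &
    forall (c : int -> V) (x : R) j k, (forall i, `|c i| <= x) ->
      `|iter j (Slin alpha) c k| <= M * x /\
      `|Delta (iter j (Slin alpha) c) k| <= M * g ^+ j * x].
Proof.
move=> [n alpha0] consts /(convergent_delta alpha0)[[M0 M00 aM] asmooth].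
pose w : R := (n.+1).*2.+1%:R; pose e := (2 * w * n.+1%:R)^-1.
have w0 : 0 < w by rewrite ltr0n.
have e0 : 0 < e by rewrite invr_gt0 !mulr_gt0.
have [J JP] := asmooth e e0.
have half (c : int -> V) y k : (forall i, `|Delta c i| <= y) ->
    `|Delta (iter J.+1 (Slin alpha) c) k| <= y / 2.
  move=> cy; apply: le_trans
    (Delta_iter_Slin_le k alpha0 consts (ltW e0) (fun k => JP J.+1 k _) cy) _ => //.
  rewrite le_eqVlt; apply/orP; left; apply/eqP; rewrite /e -/w.
  have : n.+1%:R != 0 :> R by rewrite pnatr_eq0.
  move: (n.+1%:R) => v v0; field.
  by rewrite v0 gt_eqF.
(* By the Bernoulli inequality, [m] steps at the rate [g] lose at most the
   factor 1/2. *)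
pose m := J.+1; pose g : R := 1 - (2 * m%:R)^-1.
have m1 : 1 <= m%:R :> R by rewrite ler1n.
have g12 : 2^-1 <= g.
  have : (2 * m%:R)^-1 <= 2^-1 :> R.
    by rewrite lef_pV2 ?posrE ?mulr_gt0 ?ltr0n // ler_peMr.
  rewrite /g; lra.
have g0 : 0 < g by apply: lt_le_trans g12.
have g1 : g < 1 by rewrite ltrBlDr ltrDl invr_gt0 mulr_gt0 ?ltr0n.
have bern (i : nat) : 1 - i%:R * (2 * m%:R)^-1 <= g ^+ i.
  elim: i => [|i IH]; first by rewrite mul0r subr0.
  rewrite exprS; apply: le_trans (ler_wpM2l (ltW g0) IH).
  rewrite /g -natr1; set t := (2 * _)^-1.
  have : 0 <= i%:R * t * t by rewrite !mulr_ge0 // invr_ge0 mulr_ge0.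
  lra.
have gm : 2^-1 <= g ^+ m.
  apply: le_trans (bern m); rewrite le_eqVlt; apply/orP; left; apply/eqP.
  by field; rewrite gt_eqF ?ltr0n.
pose B := w * M0.
have B0 : 0 <= B by rewrite mulr_ge0 // ltW.
have bnd (c : int -> V) x j k : (forall i, `|c i| <= x) ->
    `|iter j (Slin alpha) c k| <= B * x.
  by move=> cx; exact: (iter_Slin_norm_le k alpha0 M00 (aM j) cx).
have Dbnd (c : int -> V) x j k : (forall i, `|c i| <= x) ->
    `|Delta (iter j (Slin alpha) c) k| <= 2 * B * x.
  move=> cx; apply: le_trans (ler_normB _ _) _.
  by rewrite -mulrA mulr2n mulrDl mul1r; apply: lerD; exact: bnd.
have blocks (c : int -> V) x r i k : (forall i, `|c i| <= x) ->
    `|Delta (iter (i * m + r) (Slin alpha) c) k| <= 2 * B * x / 2 ^+ i.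
  move=> cx; elim: i k => [|i IH] k; first by rewrite divr1; exact: Dbnd.
  rewrite mulSn -addnA iterD exprSr invfM mulrA; exact: half.
(* One factor 2 comes from a difference of two entries, the other one makes up
   for the incomplete block, since [g ^+ r] is at least 1/2 for [r < m]. *)
exists (1 + 4 * B), g; split=> //; first by rewrite lerDl mulr_ge0.
move=> c x j k cx; have x0 : 0 <= x by apply: le_trans (cx 0).
have Bx : 0 <= B * x by rewrite mulr_ge0.
split; first by apply: le_trans (bnd c x j k cx) _; nra.
rewrite (divn_eq j m).
apply: le_trans (blocks c x (j %% m)%N (j %/ m)%N k cx) _.
rewrite exprD mulnC exprM.
have gr : 2^-1 <= g ^+ (j %% m)%N.
  apply: le_trans gm _; apply: ler_wiXn2l; [exact: ltW|exact: ltW|].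
  by rewrite ltnW // ltn_mod.
have gi : (2 ^+ (j %/ m)%N)^-1 <= (g ^+ m) ^+ (j %/ m)%N.
  by rewrite -exprVn lerXn2r ?nnegrE // ?invr_ge0 // exprn_ge0 // ltW.
have i0 : 0 <= (2 ^+ (j %/ m)%N)^-1 :> R by rewrite invr_ge0 exprn_ge0.
set a := (2 ^+ _)^-1 in gi i0 *; set b := (g ^+ m) ^+ _ in gi *.
set d := g ^+ _ in gr *.
have ab : a * 2^-1 <= b * d by apply: ler_pM.
have := ler_wpM2r Bx ab.
have : 0 <= b * d * x by rewrite !mulr_ge0 //; [exact: le_trans gi|exact: le_trans gr].
nra.
Qed.

(** * Accumulation of errors over the levels *)

(** The product of the growth factors [1 + a * rho ^+ k] is dominated by the
    exponential of the geometric series. *)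
Lemma discrete_gronwall (R : realType) (a rho : R) :
  0 <= a -> 0 < rho < 1 -> exists2 G : R, 0 < G &
  forall X delta : nat -> R, 0 <= X 0%N -> (forall k, 0 <= delta k) ->
    (forall k, X k.+1 <= (1 + a * rho ^+ k) * X k + a * delta k.+1) ->
    forall k, X k <= G * (X 0%N + a * \sum_(1 <= i < k.+1) delta i).
Proof.
move=> a0 /andP[r0 r1]; exists (expR (a / (1 - rho))); first exact: expR_gt0.
move=> X delta X0 d0 step k.
have r1' : 0 < 1 - rho by rewrite subr_gt0.
pose s k := a * ((1 - rho ^+ k) / (1 - rho)).
have s0 j : 0 <= s j.
  by rewrite mulr_ge0 // divr_ge0 ?(ltW r1') // subr_ge0 exprn_ile1 // ltW.
have sS j : s j.+1 = s j + a * rho ^+ j.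
  by rewrite /s exprS; field; rewrite gt_eqF.
pose Z j := X 0%N + a * \sum_(1 <= i < j.+1) delta i.
have Z0 j : 0 <= Z j by rewrite addr_ge0 // mulr_ge0 // sumr_ge0.
have XZ : X k <= expR (s k) * Z k.
  elim: k => [|k IH].
    by rewrite /Z big_geq // mulr0 addr0 ler_peMl // -expR0 ler_expR.
  apply: le_trans (step k) _.
  have -> : Z k.+1 = Z k + a * delta k.+1.
    by rewrite /Z big_nat_recr //= mulrDr addrA.
  rewrite mulrDr; apply: lerD; last first.
    by rewrite ler_peMl ?mulr_ge0 // -expR0 ler_expR.
  have ar : 0 <= 1 + a * rho ^+ k.
    by rewrite addr_ge0 // mulr_ge0 // exprn_ge0 // ltW.
  apply: le_trans (ler_wpM2l ar IH) _; rewrite mulrA ler_wpM2r // sS expRD mulrC.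
  by rewrite ler_wpM2l ?expR_ge0 // expR_ge1Dx.
apply: le_trans XZ _; rewrite ler_wpM2r // ler_expR /s ler_wpM2l //.
by rewrite ler_piMl ?invr_ge0 ?(ltW r1') // gerBl exprn_ge0 // ltW.
Qed.

Lemma geometric_sum_le (R : realType) (rho : R) (k : nat) : 0 < rho < 1 ->
  \sum_(1 <= i < k.+1) rho ^+ i <= (1 - rho)^-1.
Proof.
move=> /andP[r0 r1]; have r1' : 0 < 1 - rho by rewrite subr_gt0.
have : \sum_(1 <= i < k.+1) rho ^+ i <= (1 - rho ^+ k) / (1 - rho).
  elim: k => [|k IH]; first by rewrite big_geq // subrr mul0r.
  rewrite big_nat_recr //=; apply: le_trans (lerD IH (lexx _)) _.
  have -> : (1 - rho ^+ k.+1) / (1 - rho) = (1 - rho ^+ k) / (1 - rho) + rho ^+ k.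
    by rewrite exprS; field; rewrite gt_eqF.
  by rewrite lerD2l exprS ler_piMl ?exprn_ge0 ?ltW.
move/le_trans; apply; rewrite ler_piMl ?invr_ge0 ?(ltW r1') //.
by rewrite gerBl exprn_ge0 // ltW.
Qed.

(** The size [X] of the errors grows by summable relative amounts as long as
    their differences decay like [rho ^+ k].  The latter is kept up by the
    contraction of differences at the faster rate [g], provided that the errors
    are small.  All iterates [j] are bounded at once: the supremum over [j] is an
    equivalent norm in which one step of the rule is nonexpansive. *)
Lemma perturbed_contraction (R : realType) (V : normedModType R)
    (alpha : int -> R) (n : nat) (M g rho a : R) :
  (forall i : int, n%:Z < `|i| -> alpha i = 0) ->
  1 <= M -> 0 < g -> g < rho -> rho < 1 -> 0 < a ->
  (forall (c : int -> V) (x : R) j k, (forall i, `|c i| <= x) ->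
      `|iter j (Slin alpha) c k| <= M * x /\
      `|Delta (iter j (Slin alpha) c) k| <= M * g ^+ j * x) ->
  exists G E : R, [/\ 0 < G, 0 < E &
    forall (e : nat -> int -> V) (delta : nat -> R) (x : R),
      (forall i, `|e 0%N i| <= x) -> x <= E ->
      (forall k, 0 <= delta k) -> (forall k, delta k.+1 <= E * rho ^+ k.+1) ->
      (forall k X, (forall i, `|e k i| <= X) ->
         (forall i, `|Delta (e k) i| <= rho ^+ k) ->
         forall i, `|e k.+1 i - Slin alpha (e k) i|
                     <= a * (rho ^+ k * X + delta k.+1)) ->
      forall k i, `|e k i| <= G * (x + \sum_(1 <= i < k.+1) delta i)].
Proof.
move=> alpha0 M1 g0 gr r1 a0 contr.
have M0 : 0 < M by apply: lt_le_trans M1.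
have r0 : 0 < rho by apply: lt_trans gr.
have r01 : 0 < rho < 1 by rewrite r0.
have Ma0 : 0 < M * a by rewrite mulr_gt0.
have [G0 G00 G0P] := discrete_gronwall (ltW Ma0) r01.
pose G := G0 * (M * (1 + a)).
have Gpos : 0 < G by rewrite !mulr_gt0 // addr_gt0.
pose H := G * (1 + (1 - rho)^-1).
have r1' : 0 < (1 - rho)^-1 by rewrite invr_gt0 subr_gt0.
have H0 : 0 < H by rewrite mulr_gt0 // addr_gt0.
have q0 : 0 < M * (1 + a) * (1 + H) by rewrite !mulr_gt0 // addr_gt0.
(* [E] makes the increments of the differences fit into the gap between the
   rates [g] and [rho]. *)
pose E := (rho - g) / (M * (1 + a) * (1 + H)).
have E0 : 0 < E by rewrite divr_gt0 // subr_gt0.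
have EE : M * (1 + a) * (1 + H) * E = rho - g.
  by rewrite mulrC divfK // gt_eqF.
exists G, E; split=> // e delta x ex xE d0 dE step.
have x0 : 0 <= x by apply: le_trans (ex 0).
pose X := fix X k := if k is k'.+1
  then (1 + M * a * rho ^+ k') * X k' + M * a * delta k else M * x.
have XG k : X k <= G * (x + \sum_(1 <= i < k.+1) delta i).
  have := G0P X delta _ d0 (fun _ => lexx _) k.
  move=> /(_ _)/wrap[|]; first by rewrite mulr_ge0 // ltW.
  move/le_trans; apply; rewrite /G -[leRHS]mulrA ler_pM2l //=.
  set s := \sum_(_ <= _ < _) _; have s0 : 0 <= s by apply: sumr_ge0.
  have := mulr_ge0 (ltW M0) s0; have := mulr_ge0 (ltW Ma0) x0; lra.
have XH k : X k <= H * E.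
  apply: le_trans (XG k) _; rewrite /H -[leRHS]mulrA ler_pM2l // mulrDl mul1r.
  apply: lerD => //; rewrite mulrC.
  apply: le_trans (ler_wpM2l (ltW E0) (geometric_sum_le k r01)).
  rewrite mulr_sumr; apply: ler_sum_nat => -[//|i] _; exact: dE.
suff inv k : forall j i, `|iter j (Slin alpha) (e k) i| <= X k /\
    `|Delta (iter j (Slin alpha) (e k)) i| <= rho ^+ k * g ^+ j.
  by move=> k i; apply: le_trans (XG k); have [] := inv k 0%N i.
elim: k => [|k IH] j i.
  have [h1 h2] := contr _ _ j i ex; split=> //.
  apply: le_trans h2 _; rewrite mulrAC ler_wpM2r ?exprn_ge0 ?(ltW g0) //= expr0.
  apply: le_trans (ler_wpM2l (ltW M0) xE) _.
  have h : 0 <= a + H + a * H by have := mulr_ge0 (ltW a0) (ltW H0); lra.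
  have := mulr_ge0 (mulr_ge0 (ltW M0) (ltW E0)) h.
  move: EE; lra.
pose r i := e k.+1 i - Slin alpha (e k) i.
have Xk : 0 <= X k by have [/(le_trans _)->] := IH 0%N 0.
have rle l : `|r l| <= a * (rho ^+ k * X k + delta k.+1).
  apply: step => l'; first by have [] := IH 0%N l'.
  by have [_] := IH 0%N l'; rewrite expr0 mulr1.
have split_ l : iter j (Slin alpha) (e k.+1) l =
    iter j (Slin alpha) r l + iter j.+1 (Slin alpha) (e k) l.
  rewrite iterSr -[X in X + _]scale1r -(iter_Slin_linear _ _ _ _ _ alpha0).
  by congr (iter j _ _ l); apply/funext => l'; rewrite scale1r subrK.
have [r1l r2l] := contr r _ j i rle; have [e1 e2] := IH j.+1 i.
split.
  rewrite split_; apply: le_trans (ler_normD _ _) _.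
  by apply: le_trans (lerD r1l e1) _ => /=; lra.
rewrite /Delta !split_ opprD addrACA; apply: le_trans (ler_normD _ _) _.
apply: le_trans (lerD r2l e2) _.
have gj : 0 <= g ^+ j by rewrite exprn_ge0 // ltW.
have rk : 0 <= rho ^+ k by rewrite exprn_ge0 // ltW.
have -> : M * g ^+ j * (a * (rho ^+ k * X k + delta k.+1)) +
  rho ^+ k * g ^+ j.+1 =
  g ^+ j * (M * a * (rho ^+ k * X k + delta k.+1) + rho ^+ k * g).
  by rewrite exprS; ring.
rewrite exprS [leRHS]mulrC; apply: ler_wpM2l => //.
have dk : delta k.+1 <= rho ^+ k * E.
  apply: le_trans (dE k) _; rewrite mulrC ler_pM2r // exprS.
  by rewrite ler_piMl // ltW.
have s1 : rho ^+ k * X k + delta k.+1 <= rho ^+ k * (H * E + E).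
  by rewrite mulrDr; apply: lerD => //; apply: ler_wpM2l.
apply: le_trans (lerD (ler_wpM2l (ltW Ma0) s1) (lexx _)) _.
rewrite [rho * _]mulrC mulrCA -mulrDr; apply: ler_wpM2l => //.
have : M * a * (H * E + E) <= rho - g.
  have h : 0 <= 1 + H by lra.
  have := mulr_ge0 (mulr_ge0 (ltW M0) h) (ltW E0); rewrite -EE.
  lra.
lra.
Qed.

(** * Upscaling and downscaling operators *)

(** Both the rule and its linearization reproduce constants, because constant
    perturbations of constants are reproduced. *)
Lemma Slin_constants (R : realType) (V : normedModType R) (U : set V)
    (S : (int -> V) -> (int -> V)) (alpha : int -> R) (p u : V) (k : int) :
  open U -> U p -> reproduces_constants U S ->
  has_differential U S (fun _ => p) (Slin alpha) ->
  Slin alpha (fun _ => u) k = u.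
Proof.
move=> Uo Up Sc hS; apply/eqP; rewrite -subr_eq0 -normr_le0.
have hu : forall i : int, `|(fun _ => u) i| <= `|u| by [].
apply: (differential_le hS hu); have [r r0 rP] := constant_perturbation_in Uo Up hu.
exists r => // s s0 sr; have Us := rP s s0 sr; split=> //.
have -> : (fun=> p) \+ (fun=> s *: u) = (fun _ : int => p + s *: u) by [].
by rewrite !Sc //; [rewrite [p + _]addrC addrK subrr normr0 mulr0|exact: (Us 0)].
Qed.

Lemma upscaling_linearization (R : realType) (V : normedModType R) (U : set V)
    (S : (int -> V) -> (int -> V)) (alpha : int -> R) :
  open U -> convex_set U -> upscaling U S -> C1_lipschitz U S ->
  finitely_supported alpha ->
  (forall p, U p -> has_differential U S (fun _ => p) (Slin alpha)) ->
  exists2 K : R, 0 < K & forall c c' x y, seq_in U c -> seq_in U c' ->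
    (forall i, `|Delta c i| <= y) -> (forall i, `|Delta c' i| <= y) ->
    (forall i, `|c' i - c i| <= x) ->
    forall k, `|S c' k - S c k - Slin alpha (fun i => c' i - c i) k| <= K * y * x.
Proof.
move=> Uo Uc [[m locS] _] [dS [dSP [K K0 dSK]]] [n alpha0] fo.
pose w := (maxn m n).+1.
exists (K * w%:R); first by rewrite mulr_gt0 // ltr0n.
move=> c c' x y Uc1 Uc2 cy c'y cx k; rewrite -[K * _ * y]mulrA.
apply: (@linearization_le _ _ U S _ dS K k (k %/ 2)%Z w) => //.
- by move=> c0 c1 U0 U1 c01; apply: locS => // l kl; apply: c01; rewrite /w; lia.
- move=> h0 h1 h01; apply: (Slin_local alpha0) => l kl; apply: h01.
  by rewrite /w; lia.
- by move=> l; apply: oscillation_le.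
- by move=> l; apply: oscillation_le.
Qed.

Lemma quadratic_le (R : realType) (a K w y Y : R) : 0 <= K -> 0 <= w ->
  0 <= y -> y <= Y ->
  a * (w * y) + K * (w * y) * (w * y) <= (a * w + K * w * w * `|Y| + 1) * y.
Proof.
move=> K0 w0 y0 yY; rewrite ger0_norm ?(le_trans y0) //.
have : 0 <= K * w * w * y * (Y - y) by rewrite !mulr_ge0 // subr_ge0.
lra.
Qed.

(** The linearization error is quadratic in the oscillation [y]; the bound [Y]
    turns it into a linear one. *)
Lemma upscaling_near_data (R : realType) (V : normedModType R) (U : set V)
    (S : (int -> V) -> (int -> V)) (alpha : int -> R) (Y : R) :
  open U -> convex_set U -> upscaling U S -> C1_lipschitz U S ->
  reproduces_constants U S -> finitely_supported alpha ->
  (forall p, U p -> has_differential U S (fun _ => p) (Slin alpha)) ->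
  exists2 K : R, 0 < K & forall c y, seq_in U c ->
    (forall i, `|Delta c i| <= y) -> y <= Y ->
    forall k, `|S c k - c (k %/ 2)%Z| <= K * y.
Proof.
move=> Uo Uc [[m locS] _] [dS [dSP [K K0 dSK]]] Sc [n alpha0] fo.
have [M M0 aM] := @finitely_supported_bounded _ alpha (ex_intro _ n alpha0).
pose w := (maxn m n).+1; pose a := (n.+1).*2.+1%:R * M.
have a0 : 0 <= a by rewrite mulr_ge0.
exists (a * w%:R + K * w%:R * w%:R * `|Y| + 1).
  by rewrite ltr_wpDl // addr_ge0 ?mulr_ge0 // ltW.
move=> c y Uc1 cy yY k.
have y0 : 0 <= y by apply: le_trans (cy 0).
have osc l : `|l - (k %/ 2)%Z| <= w%:Z -> `|c l - c (k %/ 2)%Z| <= w%:R * y.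
  exact: oscillation_le.
have := @near_constant_le _ _ U S (Slin alpha) dS K a k (k %/ 2)%Z w c (w%:R * y)
  Uo Uc K0 dSP dSK fo Sc.
move=> /(_ _)/wrap[|].
  by move=> c0 c1 U0 U1 c01; apply: locS => // l kl; apply: c01; rewrite /w; lia.
move=> /(_ _)/wrap[|].
  move=> h0 h1 h01; apply: (Slin_local alpha0) => l kl; apply: h01.
  by rewrite /w; lia.
move=> /(_ _)/wrap[|].
  move=> h x hx; apply: (Slin_norm_le alpha0 aM) => l kl; apply: hx.
  by rewrite /w; lia.
move=> /(_ Uc1 osc) /le_trans; apply.
exact: quadratic_le (ltW K0) _ y0 yY.
Qed.

Lemma downscaling_near_data (R : realType) (V : normedModType R) (U : set V)
    (D : (int -> V) -> (int -> V)) (beta : int -> R) (Y : R) :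
  open U -> convex_set U -> downscaling U D -> C1_lipschitz U D ->
  reproduces_constants U D -> finitely_supported beta ->
  (forall p, U p -> has_differential U D (fun _ => p) (Dlin beta)) ->
  exists2 K : R, 0 < K & forall c y, seq_in U c ->
    (forall i, `|Delta c i| <= y) -> y <= Y ->
    forall k, `|D c k - c (2 * k)| <= K * y.
Proof.
move=> Uo Uc [[m locD] _] [dD [dDP [K K0 dDK]]] Dc [n beta0] fo.
have [M M0 bM] := @finitely_supported_bounded _ beta (ex_intro _ n beta0).
pose w := (maxn m n).+1; pose a := n.*2.+1%:R * M.
have a0 : 0 <= a by rewrite mulr_ge0.
exists (a * w%:R + K * w%:R * w%:R * `|Y| + 1).
  by rewrite ltr_wpDl // addr_ge0 ?mulr_ge0 // ltW.
move=> c y Uc1 cy yY k.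
have y0 : 0 <= y by apply: le_trans (cy 0).
have osc l : `|l - 2 * k| <= w%:Z -> `|c l - c (2 * k)| <= w%:R * y.
  exact: oscillation_le.
have := @near_constant_le _ _ U D (Dlin beta) dD K a k (2 * k) w c (w%:R * y)
  Uo Uc K0 dDP dDK fo Dc.
move=> /(_ _)/wrap[|].
  by move=> c0 c1 U0 U1 c01; apply: locD => // l kl; apply: c01; rewrite /w; lia.
move=> /(_ _)/wrap[|].
  move=> h0 h1 h01; apply: (Dlin_local beta0) => l kl; apply: h01.
  by rewrite /w; lia.
move=> /(_ _)/wrap[|].
  move=> h x hx; apply: (Dlin_norm_le beta0 bM) => l kl; apply: hx.
  by rewrite /w; lia.
move=> /(_ Uc1 osc) /le_trans; apply.
exact: quadratic_le (ltW K0) _ y0 yY.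
Qed.

(** The downscaled data stay close to every second entry of [c], hence have a
    small oscillation themselves, and upscaling stays close to them in turn. *)
Lemma up_down_near_data (R : realType) (V : normedModType R) (U : set V)
    (S D : (int -> V) -> (int -> V)) (Y K K' : R) :
  0 < K -> 0 < K' -> preserves U D ->
  (forall c y, seq_in U c -> (forall i, `|Delta c i| <= y) -> y <= Y ->
    forall k, `|D c k - c (2 * k)| <= K * y) ->
  (forall c y, seq_in U c -> (forall i, `|Delta c i| <= y) ->
    y <= (2 * K + 2) * Y -> forall k, `|S c k - c (k %/ 2)%Z| <= K' * y) ->
  forall c y, seq_in U c -> (forall i, `|Delta c i| <= y) -> y <= Y ->
    forall k, `|c k - S (D c) k| <= (K' * (2 * K + 2) + K + 1) * y.
Proof.
move=> K0 K'0 UD Dn Sn c y Uc cy yY k.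
have y0 : 0 <= y by apply: le_trans (cy 0).
have K2 : 0 < 2 * K + 2 by rewrite addr_gt0 // mulr_gt0.
have Dd i : `|Delta (D c) i| <= (2 * K + 2) * y.
  have hl := Dn c y Uc cy yY i; have hr := Dn c y Uc cy yY (i + 1).
  have hm : `|c (2 * (i + 1)) - c (2 * i)| <= 2%:R * y.
    by apply: oscillation_le => //; lia.
  rewrite /Delta -(subrKA (c (2 * (i + 1)))); apply: le_trans (ler_normD _ _) _.
  rewrite -[X in _ + `|X|](subrKA (c (2 * i))) distrC in hl *.
  apply: le_trans (lerD hr (le_trans (ler_normD _ _) (lerD hm hl))) _; lra.
have h1 := Sn (D c) _ (UD c Uc) Dd (ler_wpM2l (ltW K2) yY) k.
have h2 := Dn c y Uc cy yY (k %/ 2)%Z.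
have h3 : `|c k - c (2 * (k %/ 2)%Z)| <= 1%:R * y.
  by apply: oscillation_le => //; lia.
rewrite distrC -(subrKA (D c (k %/ 2)%Z)); apply: le_trans (ler_normD _ _) _.
rewrite -[X in _ + `|X|](subrKA (c (2 * (k %/ 2)%Z))).
apply: le_trans (lerD h1 (le_trans (ler_normD _ _) (lerD h2 _))) _.
  by rewrite distrC; exact: h3.
by rewrite mul1r; lra.
Qed.

(** * Stability of reconstruction *)

(** One reconstruction step: the details are as small as the oscillation of the
    data, hence so is the nonlinear part of adding them. *)
Lemma reconstruction_step (R : realType) (V W : normedModType R)
    (U : set V) (dom_plus : set (V * W)) (dom_minus : set (V * V))
    (oplus : V -> W -> V) (ominus : V -> V -> W)
    (S D : (int -> V) -> (int -> V)) (Q Rd : (int -> W) -> (int -> W))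
    (alpha beta : int -> R) (c : nat -> int -> V) (mu C : R) :
  point_vector_ops U dom_plus dom_minus oplus ominus ->
  multiscale_operators U S D Q Rd alpha beta ->
  qmf U dom_plus dom_minus oplus ominus S D Q Rd ->
  data_pyramid U dom_plus dom_minus ominus S D Q Rd c ->
  0 < mu < 1 -> 0 < C -> (forall j i, `|Delta (c j) i| <= C * mu ^+ j) ->
  exists2 a : R, 0 < a & forall c' d' k z delta,
    reconstructed_pyramid U dom_plus oplus S Rd c' d' ->
    (forall i, `|S (c k) i - S (c' k) i| <= z) ->
    (forall i, `|detail ominus S Q c k.+1 i - d' k.+1 i| <= delta) ->
    delta <= 1 ->
    forall i, `|(c k.+1 i - c' k.+1 i) - (S (c k) i - S (c' k) i)|
                <= a * (mu ^+ k * z + delta).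
Proof.
move=> ops tech mirror pyr /andP[mu0 mu1] C0 decay.
have Uo := pvo_open_points ops; have Uc := pvo_convex_points ops.
have [A [B [A0 B0 AB]]] := pvo_bilipschitz ops.
have [KD KD0 KDP] := downscaling_near_data C Uo Uc (mo_D_downscaling tech)
  (mo_D_smooth tech) (mo_D_constants tech) (mo_beta_finite tech)
  (mo_D_first_order tech).
have [KS KS0 KSP] := upscaling_near_data ((2 * KD + 2) * C) Uo Uc
  (mo_S_upscaling tech) (mo_S_smooth tech) (mo_S_constants tech)
  (mo_alpha_finite tech) (mo_S_first_order tech).
pose KSD := KS * (2 * KD + 2) + KD + 1.
have KSD0 : 0 < KSD by rewrite !addr_gt0 // mulr_gt0 // addr_gt0 // mulr_gt0.
have near := up_down_near_data KD0 KS0 (mo_D_preserves tech) KDP KSP.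
have [CQ CQ0 CQP] := bounded_op_le (mo_Q_bounded tech).
have [CR CR0 CRP] := bounded_op_le (mo_R_bounded tech).
pose Bd := CQ * (B * (KSD * C)).
have Bd0 : 0 < Bd by rewrite !mulr_gt0.
have muC k : C * mu ^+ k <= C.
  by rewrite ler_piMr ?(ltW C0) // exprn_ile1 // ltW.
have dle k i : `|detail ominus S Q c k.+1 i| <= Bd * mu ^+ k.+1.
  rewrite /Bd -!mulrA; apply: CQP => l; rewrite /elementwise.
  have := AB _ _ (dp_minus_defined pyr (ltn0Sn k) l) => /andP[_].
  move/le_trans; apply; rewrite ler_pM2l //.
  rewrite (dp_down pyr (ltn0Sn k)) /=.
  exact: near (dp_in pyr k.+1) (decay k.+1) (muC k.+1) l.
have [LR LR0 LRP] := bounded_op_lipschitz (mo_R_bounded tech) (mo_R_smooth tech)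
  (Bd + 1).
have [K KP] := pvo_lipschitz_plus ops.
have [L LP] := pvo_lipschitz_diff_plus ops.
have df x : dom_plus x -> differentiable (fun x : V * W => oplus x.1 x.2) x.
  by have [df _] := pvo_smooth_plus ops 1%N; exact: df.
have plus0 p : U p -> oplus p 0 = p.
  move=> Up; have pp := pvo_diagonal ops Up.
  have [_ {2}<-] := pvo_plus_minus ops pp.
  congr (oplus p _); apply/eqP; rewrite eq_sym -normr_le0.
  by have /andP[_] := AB _ _ pp; rewrite subrr normr0 mulr0.
pose a := `|L| * CR * Bd * (1 + LR) + `|K| * LR + 1.
have a1 : 0 < a.
  have h1 := mulr_ge0 (mulr_ge0 (mulr_ge0 (normr_ge0 L) (ltW CR0)) (ltW Bd0))
    (addr_ge0 ler01 (ltW LR0)).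
  by rewrite ltr_wpDl // addr_ge0 // mulr_ge0 // ltW.
exists a => // c' d' k z delta rec Sz dd d1 i.
have z0 : 0 <= z by apply: le_trans (Sz 0).
have d0 : 0 <= delta by apply: le_trans (dd 0).
have mu1k j : mu ^+ j <= 1 by rewrite exprn_ile1 // ltW.
have Bd1 j : `|detail ominus S Q c k.+1 j| <= Bd + 1.
  apply: le_trans (dle k j) _; apply: (@le_trans _ _ Bd); last by rewrite lerDl.
  by rewrite ler_piMr // ltW.
have d'B j : `|d' k.+1 j| <= Bd + 1.
  rewrite -[d' _ _](subKr (detail ominus S Q c k.+1 j)).
  apply: le_trans (ler_normB _ _) _; apply: lerD; last exact: le_trans (dd j) _.
  by apply: le_trans (dle k j) _; rewrite ler_piMr // ltW.
set v := Rd (detail ominus S Q c k.+1); set v' := Rd (d' k.+1).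
have vv' : `|v i - v' i| <= LR * delta by apply: LRP d'B Bd1 dd i.
have vle : `|v i| <= CR * Bd * mu ^+ k.
  rewrite -mulrA; apply: CRP => j; apply: le_trans (dle k j) _.
  by rewrite ler_pM2l // exprS ler_piMl ?exprn_ge0 // ltW.
have dp : dom_plus (S (c k) i, v i).
  by have := dp_plus_defined pyr (ltn0Sn k) i.
have dp' : dom_plus (S (c' k) i, v' i) := rp_plus_defined rec (ltn0Sn k) i.
have cE : c k.+1 i = oplus (S (c k) i) (v i).
  have := mirror (c k.+1) (dp_in pyr k.+1).
  rewrite -(dp_down pyr (ltn0Sn k)) /= => mir.
  have := mir (dp_minus_defined pyr (ltn0Sn k)) (dp_plus_defined pyr (ltn0Sn k)).
  by move/(congr1 (fun f => f i)) => <-.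
have c'E : c' k.+1 i = oplus (S (c' k) i) (v' i).
  by rewrite (rp_step rec (ltn0Sn k)).
rewrite cE c'E.
have US := mo_S_preserves tech.
have := @oplus_increment_le _ _ _ dom_plus oplus K `|L| _ _ _ _ (pvo_open_plus ops)
  (fun q u t => @pvo_star _ _ _ _ _ _ _ _ ops q u t) df KP (normr_ge0 L) _ dp dp'
  (plus0 _ (US _ (dp_in pyr k) i)) (plus0 _ (US _ (rp_in rec k) i)).
move=> /(_ _)/wrap[|].
  move=> x y u dx dy; apply: le_trans (LP x y u dx dy) _.
  by rewrite !ler_wpM2r // ler_norm.
move/le_trans; apply.
have m0 : 0 <= mu ^+ k by rewrite exprn_ge0 // ltW.
have s1 : `|S (c k) i - S (c' k) i| + `|v i - v' i| <= z + LR * delta.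
  by apply: lerD.
have s2 : `|L| * (`|S (c k) i - S (c' k) i| + `|v i - v' i|) * `|v i| <=
    `|L| * (z + LR * delta) * (CR * Bd * mu ^+ k).
  by apply: ler_pM; rewrite ?mulr_ge0 ?addr_ge0 //; apply: ler_wpM2l.
have s3 : K * `|v i - v' i| <= `|K| * (LR * delta).
  by apply: le_trans (ler_wpM2r _ (ler_norm K)) _ => //; apply: ler_wpM2l.
apply: le_trans (lerD s2 s3) _.
set l := `|L|; set m := mu ^+ k in m0 *.
have l0 : 0 <= l by rewrite /l.
have h1 : l * (z + LR * delta) * (CR * Bd * m) <=
   l * CR * Bd * (1 + LR) * (m * z + delta).
  have e1 : 0 <= l * CR * Bd by rewrite !mulr_ge0 // ltW.
  have -> : l * (z + LR * delta) * (CR * Bd * m) =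
    l * CR * Bd * (m * z + LR * (m * delta)) by ring.
  rewrite -[leRHS]mulrA; apply: ler_wpM2l => //.
  have md : m * delta <= delta by rewrite ler_piMl // /m.
  have := ler_wpM2l (ltW LR0) md; have := mulr_ge0 (ltW LR0) (mulr_ge0 m0 z0).
  lra.
have h2 : `|K| * (LR * delta) <= `|K| * LR * (m * z + delta).
  by rewrite mulrA ler_wpM2l ?mulr_ge0 ?(ltW LR0) // lerDr mulr_ge0.
apply: le_trans (lerD h1 h2) _; rewrite /a -/l -mulrDl.
by rewrite ler_wpM2r ?addr_ge0 ?mulr_ge0 // lerDl.
Qed.

(** The splitting rule does not contract differences; instead there is no
    linearization error to be controlled by them. *)
Lemma haar_nonexpansive (R : realType) (V : normedModType R) (U : set V)
    (S : (int -> V) -> (int -> V)) (alpha : int -> R) c c' (x : R) :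
  haar_case U S alpha -> seq_in U c -> seq_in U c' ->
  (forall i, `|c i - c' i| <= x) -> forall i, `|S c i - S c' i| <= x.
Proof.
move=> haar Uc Uc' cx i; have [_ h] := haar c Uc; have [_ h'] := haar c' Uc'.
have [h0 h1] := h (i %/ 2)%Z; have [h'0 h'1] := h' (i %/ 2)%Z.
have [E|E] : i = 2 * (i %/ 2)%Z \/ i = 2 * (i %/ 2)%Z + 1 by lia.
  by rewrite E h0 h'0.
by rewrite E h1 h'1.
Qed.

Theorem theorem3p1 (R : realType) (V W : normedModType R)
    (V_fin : finite_dim V) (W_fin : finite_dim W)
    (U : set V) (dom_plus : set (V * W)) (dom_minus : set (V * V))
    (oplus : V -> W -> V) (ominus : V -> V -> W)
    (ops : point_vector_ops U dom_plus dom_minus oplus ominus)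
    (S D : (int -> V) -> (int -> V)) (Q Rd : (int -> W) -> (int -> W))
    (alpha beta : int -> R)
    (technical : multiscale_operators U S D Q Rd alpha beta)
    (mirror : qmf U dom_plus dom_minus oplus ominus S D Q Rd)
    (c : nat -> int -> V)
    (pyramid : data_pyramid U dom_plus dom_minus ominus S D Q Rd c)
    (mu : R) (mu_range : 0 < mu < 1)
    (decay : exists2 C : R, 0 < C &
       forall j : nat, (supnorm (Delta (c j)) <= (C * mu ^+ j)%:E)%E) :
  let d := detail ominus S Q c in
  exists D0 E1 E2 : R, [/\ 0 < D0, 0 < E1, 0 < E2 &
    forall (j : nat) (c' : nat -> int -> V) (d' : nat -> int -> W),
      reconstructed_pyramid U dom_plus oplus S Rd c' d' ->
      (supnorm (c 0%N \- c' 0%N) <= E1%:E)%E ->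
      (forall k : nat, (0 < k)%N ->
         (supnorm (d k \- d' k) <= (E2 * mu ^+ k)%:E)%E) ->
      (supnorm (c j \- c' j) <=
         D0%:E * (supnorm (c 0%N \- c' 0%N) +
                  \sum_(1 <= k < j.+1) supnorm (d k \- d' k)))%E].
Proof.
move=> d; have [mu0 mu1] := andP mu_range; have [C C0 decayC] := decay.
have Dc j i : `|Delta (c j) i| <= C * mu ^+ j.
  by have /supnorm_leP := decayC j; apply.
have [a a0 step] := reconstruction_step ops technical mirror pyramid mu_range C0 Dc.
have Uo := pvo_open_points ops; have Uc := pvo_convex_points ops.
suff [G [E [G0 E0 GE]]] : exists G E : R, [/\ 0 < G, 0 < E &
    forall c' d' (x : R) (delta : nat -> R),
    reconstructed_pyramid U dom_plus oplus S Rd c' d' ->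
    (forall i, `|c 0%N i - c' 0%N i| <= x) -> x <= E ->
    (forall k, 0 <= delta k) ->
    (forall k i, `|d k.+1 i - d' k.+1 i| <= delta k.+1) ->
    (forall k, delta k.+1 <= E * mu ^+ k.+1) ->
    (forall k, delta k.+1 <= 1) ->
    forall k i, `|c k i - c' k i| <= G * (x + \sum_(1 <= i < k.+1) delta i)].
  pose E2 := Num.min E 1.
  have E20 : 0 < E2 by rewrite lt_min E0 ltr01.
  exists G, E, E2; split=> // j c' d' rec c0 dd.
  have xK := fine_supnormK c0; set x := fine _ in xK.
  pose delta k := fine (supnorm (d k \- d' k)).
  have dK k : ((delta k.+1)%:E = supnorm (d k.+1 \- d' k.+1))%E.
    exact: fine_supnormK (dd k.+1 isT).
  rewrite -xK (_ : (\sum_(1 <= k < j.+1) _ = (\sum_(1 <= k < j.+1) delta k)%:E)%E);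
    last first.
    by rewrite -sumEFin; apply: eq_big_nat => -[//|k] _; rewrite dK.
  rewrite -EFinD -EFinM; apply/supnorm_leP.
  have dE2 k : delta k.+1 <= E2 * mu ^+ k.+1.
    by rewrite -lee_fin dK; exact: dd.
  have m0 k : 0 <= mu ^+ k by rewrite exprn_ge0 // ltW.
  apply: (GE c' d') => //.
  - by apply/supnorm_leP; rewrite xK.
  - by rewrite -lee_fin xK.
  - by move=> k; apply: fine_ge0; exact: supnorm_ge0.
  - by move=> k; apply/supnorm_leP; rewrite dK.
  - by move=> k; apply: le_trans (dE2 k) _; rewrite ler_wpM2r // ge_min lexx.
  - move=> k; apply: le_trans (dE2 k) _.
    by apply: mulr_ile1 => //; rewrite ?ge_min ?lexx ?orbT ?exprn_ile1 // ltW.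
have [conv|haar] := mo_convergent_or_haar technical; last first.
  have [G G0 GP] := discrete_gronwall (ltW a0) mu_range.
  exists (G * (1 + a)), 1; split; rewrite ?ltr01 ?mulr_gt0 ?addr_gt0 //.
  move=> c' d' x delta rec c0 _ d0 dd _ d1 k.
  have x0 : 0 <= x by apply: le_trans (c0 0).
  pose X := fix X k := if k is k'.+1
    then (1 + a * mu ^+ k') * X k' + a * delta k else x.
  have eX : forall i, `|c k i - c' k i| <= X k.
    elim: k => [//|k IH] i.
    have Sz := haar_nonexpansive haar (dp_in pyramid k) (rp_in rec k) IH.
    rewrite -[_ - _](subrK (S (c k) i - S (c' k) i)).
    apply: le_trans (ler_normD _ _) _.
    apply: le_trans (lerD (step _ _ _ _ _ rec Sz (dd k) (d1 k) i) (Sz i)) _ => /=.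
    lra.
  move=> i; apply: le_trans (eX i) _.
  apply: le_trans (GP X delta x0 d0 (fun _ => lexx _) k) _.
  rewrite -[leRHS]mulrA ler_pM2l //=; set s := \sum_(_ <= _ < _) _.
  have s0 : 0 <= s by apply: sumr_ge0.
  have := mulr_ge0 (ltW a0) x0; lra.
have [n alpha0] := mo_alpha_finite technical.
have consts (u : V) k : Slin alpha (fun _ => u) k = u.
  have Up := dp_in pyramid 0%N 0.
  exact: Slin_constants Uo Up (mo_S_constants technical)
    (mo_S_first_order technical Up).
have [M [g [M1 g0 g1 contr]]] :=
  convergent_contractive (mo_alpha_finite technical) consts conv.
have [K K0 KP] := upscaling_linearization Uo Uc (mo_S_upscaling technical)
  (mo_S_smooth technical) (mo_alpha_finite technical)
  (mo_S_first_order technical).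
(* [rho] exceeds both the contraction rate of the linear rule and the decay rate
   of the given pyramid. *)
pose rho := (1 + Num.max g mu) / 2.
have gm1 : Num.max g mu < 1 by rewrite gt_max g1.
have gm : Num.max g mu < rho by rewrite /rho; lra.
have grho : g < rho by apply: le_lt_trans gm; rewrite le_max lexx.
have murho : mu <= rho by apply: le_trans (ltW gm); rewrite le_max lexx orbT.
have rho1 : rho < 1 by rewrite /rho; lra.
have rho0 : 0 < rho by apply: lt_trans grho.
have M0 : 0 < M by apply: lt_le_trans M1.
pose K' := K * (C + 1).
have K'0 : 0 < K' by rewrite mulr_gt0 // addr_gt0.
pose b := K' + a * (M + K') + a.
have b0 : 0 < b by rewrite !addr_gt0 // mulr_gt0 // addr_gt0.
have [G [E [G0 E0 GE]]] :=
  perturbed_contraction alpha0 M1 g0 grho rho1 b0 contr.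
exists G, E; split=> // c' d' x delta rec c0 xE d0 dd dE d1.
have murk k : mu ^+ k <= rho ^+ k by rewrite lerXn2r ?nnegrE // ltW.
apply: (GE (fun k i => c k i - c' k i) delta x) => //.
  by move=> k; apply: le_trans (dE k) _; rewrite ler_wpM2l // ltW.
move=> k X eX eD i.
have X0 : 0 <= X by apply: le_trans (eX 0).
have rk0 : 0 <= rho ^+ k by rewrite exprn_ge0 // ltW.
have rk1 : rho ^+ k <= 1 by rewrite exprn_ile1 // ltW.
have mk0 : 0 <= mu ^+ k by rewrite exprn_ge0 // ltW.
pose y := (C + 1) * rho ^+ k.
have cy l : `|Delta (c k) l| <= y.
  apply: le_trans (Dc k l) _; rewrite /y mulrDl mul1r.
  by rewrite ler_wpDr // ler_wpM2l // ltW.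
have c'y l : `|Delta (c' k) l| <= y.
  have -> : Delta (c' k) l = Delta (c k) l - Delta (fun i => c k i - c' k i) l.
    have swap (p q r s : V) : (p - q) - (r - s) = (p - r) - (q - s).
      by rewrite opprD addrACA -opprD.
    by rewrite /Delta [in RHS]swap !subKr.
  apply: le_trans (ler_normB _ _) _; rewrite /y mulrDl mul1r; apply: lerD => //.
  by apply: le_trans (Dc k l) _; rewrite ler_wpM2l // ltW.
have lin := KP _ _ _ _ (rp_in rec k) (dp_in pyramid k) c'y cy eX.
have PX l : `|Slin alpha (fun i => c k i - c' k i) l| <= M * X.
  by have [] := contr _ _ 1%N l eX.
have Kyr : K * y * X = K' * rho ^+ k * X by rewrite /y /K'; ring.
have Sz l : `|S (c k) l - S (c' k) l| <= (M + K') * X.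
  rewrite -[_ - _](subrK (Slin alpha (fun i => c k i - c' k i) l)).
  apply: le_trans (ler_normD _ _) _.
  apply: le_trans (lerD (lin l) (PX l)) _; rewrite Kyr addrC mulrDl lerD2l.
  by rewrite ler_wpM2r // ler_piMr // ltW.
have st := step _ _ _ _ _ rec Sz (dd k) (d1 k) i.
rewrite -[X in X - _](subrK (S (c k) i - S (c' k) i)) -addrA.
apply: le_trans (ler_normD _ _) _; apply: le_trans (lerD st (lin i)) _.
rewrite Kyr /b.
have h : mu ^+ k * ((M + K') * X) <= rho ^+ k * ((M + K') * X).
  by rewrite ler_wpM2r // mulr_ge0 // addr_ge0 // ltW.
have := ler_wpM2l (ltW a0) h.
have := mulr_ge0 (ltW a0) (mulr_ge0 rk0 X0).
have q : 0 <= K' + a * (M + K').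
  by rewrite addr_ge0 ?mulr_ge0 ?addr_ge0 // ltW.
have := mulr_ge0 q (d0 k.+1).
lra.
Qed.
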